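(* Over $\mathbf{RCA}_0$ the following are equivalent: (1) $\Pi^1_1$ comprehension. (2) For any sequence of CSC spaces $(X^i)_{i\in\mathbb{N}}$ the set $\{i\in\mathbb{N}: X^i\text{ is scattered}\}$ exists. (3) For any sequence of countable metric spaces $(X^i,d^i)_{i\in\mathbb{N}}$ the set $\{i\in\mathbb{N}: (X^i,d^i)\text{ is complete}\}$ exists.
   Context: All notions are formalized in second order arithmetic. CSC space: a tuple $(X,(U_i)_{i\in\mathbb{N}},k)$ with $X\subseteq\mathbb{N}$, $(U_i)$ a sequence of subsets of $X$ such that every $x\in X$ lies in some $U_i$, and $k:X\times\mathbb{N}\times\mathbb{N}\to\mathbb{N}$ a partial function such that $x\in U_i\cap U_j$ implies $x\in U_{k(x,i,j)}\subseteq U_i\cap U_j$. A subspace $Y\subseteq X$ has basic open sets $U_i\cap Y$. $X$ is scattered if every nonempty subspace has an isolated point. Countable metric space: a pair $(X,d)$ with $X\subseteq\mathbb{N}$ and $d:X\times X\to\mathbb{R}$ a metric (reals coded as usual by rapidly converging sequences of rationals). It is complete if every Cauchy sequence of points of $X$ converges to a point of $X$ (countable metric spaces are taken as they are, not as codes for their completions). *)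

(* Defs.v *)
Set Implicit Arguments.
Unset Strict Implicit.
Unset Printing Implicit Defensive.

(** * Second order arithmetic

    Structures for the two-sorted language of second order arithmetic, with
    Henkin semantics: number quantifiers range over [num M], which may be
    nonstandard, and set quantifiers range over [nset M], which need not contain
    every subset of [num M].  "Provable over RCA_0" is read as "true in every
    model of RCA_0". *)

Record L2structure : Type := {
  num :> Type;
  nset : Type;
  zero : num;
  one : num;
  add : num -> num -> num;
  mul : num -> num -> num;
  lt : num -> num -> Prop;
  mem : num -> nset -> Prop;
  nset_inhabited : inhabited nset
}.

Arguments zero {M} : rename.
Arguments one {M} : rename.
Arguments add {M} _ _ : rename.
Arguments mul {M} _ _ : rename.
Arguments lt {M} _ _ : rename.

Definition elts (M : L2structure) (A : nset M) : M -> Prop := fun n => mem n A.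
Coercion elts : nset >-> Funclass.

Declare Scope l2_scope.
Delimit Scope l2_scope with L2.
Notation "0" := zero : l2_scope.
Notation "1" := one : l2_scope.
Notation "x + y" := (add x y) : l2_scope.
Notation "x * y" := (mul x y) : l2_scope.
Notation "x < y" := (lt x y) : l2_scope.
Notation "x <= y" := (lt x y \/ x = y) : l2_scope.
Local Open Scope l2_scope.

(** ** Formulas

    De Bruijn indices, separately for number variables and for set variables.
    The bound of a bounded quantifier lives outside the scope of that quantifier,
    so it cannot mention the bound variable. *)

Inductive term : Type :=
| TVar (i : nat)
| TZero
| TOne
| TAdd (t u : term)
| TMul (t u : term).

Inductive formula : Type :=
| FEq (t u : term)
| FLt (t u : term)
| FMem (t : term) (X : nat)
| FNot (f : formula)
| FAnd (f g : formula)
| FOr (f g : formula)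
| FImp (f g : formula)
| FBAll (t : term) (f : formula)
| FBEx (t : term) (f : formula)
| FAll (f : formula)
| FEx (f : formula)
| FSetAll (f : formula)
| FSetEx (f : formula).

Definition scons (T : Type) (x : T) (e : nat -> T) : nat -> T :=
  fun i => match i with O => x | S j => e j end.

Fixpoint eval (M : L2structure) (e : nat -> M) (t : term) : M :=
  match t with
  | TVar i => e i
  | TZero => 0
  | TOne => 1
  | TAdd t u => eval e t + eval e u
  | TMul t u => eval e t * eval e u
  end.

Fixpoint sat (M : L2structure) (e : nat -> M) (s : nat -> nset M)
    (f : formula) : Prop :=
  match f with
  | FEq t u => eval e t = eval e u
  | FLt t u => eval e t < eval e u
  | FMem t X => s X (eval e t)
  | FNot f => ~ sat e s f
  | FAnd f g => sat e s f /\ sat e s g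
  | FOr f g => sat e s f \/ sat e s g
  | FImp f g => sat e s f -> sat e s g
  | FBAll t f => forall n : M, n < eval e t -> sat (scons n e) s f
  | FBEx t f => exists n : M, n < eval e t /\ sat (scons n e) s f
  | FAll f => forall n : M, sat (scons n e) s f
  | FEx f => exists n : M, sat (scons n e) s f
  | FSetAll f => forall X : nset M, sat e (scons X s) f
  | FSetEx f => exists X : nset M, sat e (scons X s) f
  end.

Fixpoint arithmetical (f : formula) : Prop :=
  match f with
  | FEq _ _ | FLt _ _ | FMem _ _ => True
  | FNot f | FBAll _ f | FBEx _ f | FAll f | FEx f => arithmetical f
  | FAnd f g | FOr f g | FImp f g => arithmetical f /\ arithmetical g
  | FSetAll _ | FSetEx _ => False
  end.

Fixpoint Sigma00 (f : formula) : Prop :=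
  match f with
  | FEq _ _ | FLt _ _ | FMem _ _ => True
  | FNot f | FBAll _ f | FBEx _ f => Sigma00 f
  | FAnd f g | FOr f g | FImp f g => Sigma00 f /\ Sigma00 g
  | FAll _ | FEx _ | FSetAll _ | FSetEx _ => False
  end.

Definition Sigma01 (f : formula) : Prop :=
  exists g : formula, Sigma00 g /\ f = FEx g.

Definition Pi01 (f : formula) : Prop :=
  exists g : formula, Sigma00 g /\ f = FAll g.

Definition Pi11 (f : formula) : Prop :=
  exists g : formula, arithmetical g /\ f = FSetAll g.

(** ** Axioms

    In the three schemes the distinguished number variable has index 0; the
    remaining number variables and all set variables are parameters. *)

Record basic_axioms (M : L2structure) : Prop := {
  succ_neq0 : forall n : M, n + 1 <> 0;
  succ_inj : forall m n : M, m + 1 = n + 1 -> m = n;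
  add_0 : forall m : M, m + 0 = m;
  add_succ : forall m n : M, m + (n + 1) = (m + n) + 1;
  mul_0 : forall m : M, m * 0 = 0;
  mul_succ : forall m n : M, m * (n + 1) = m * n + m;
  lt_0 : forall m : M, ~ m < 0;
  lt_succ : forall m n : M, m < n + 1 <-> m < n \/ m = n
}.

Definition Sigma01_induction (M : L2structure) : Prop :=
  forall (f : formula) (e : nat -> M) (s : nat -> nset M),
    Sigma01 f ->
    sat (scons 0 e) s f ->
    (forall n : M, sat (scons n e) s f -> sat (scons (n + 1) e) s f) ->
    forall n : M, sat (scons n e) s f.

Definition Delta01_comprehension (M : L2structure) : Prop :=
  forall (f g : formula) (e : nat -> M) (s : nat -> nset M),
    Sigma01 f -> Pi01 g ->
    (forall n : M, sat (scons n e) s f <-> sat (scons n e) s g) ->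
    exists X : nset M, forall n : M, X n <-> sat (scons n e) s f.

Record RCA0 (M : L2structure) : Prop := {
  RCA0_basic : basic_axioms M;
  RCA0_induction : Sigma01_induction M;
  RCA0_comprehension : Delta01_comprehension M
}.

Definition Pi11_comprehension (M : L2structure) : Prop :=
  forall (f : formula) (e : nat -> M) (s : nat -> nset M),
    Pi11 f ->
    exists X : nset M, forall n : M, X n <-> sat (scons n e) s f.

(** * Coding of pairs, sequences of sets and functions

    All quantifiers below range over the two sorts of [M].  Arguments of type
    [M -> Prop] are only ever instantiated with sets of [M], with their sections
    and with other sets which are Delta^0_1 in them. *)

Section Coding.
Variable M : L2structure.

Definition pair (m n : M) : M := (m + n) * (m + n) + m.

(** The [i]-th term of the sequence of sets coded by [W]. *)
Definition section (W : M -> Prop) (i : M) : M -> Prop :=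
  fun m => W (pair m i).

Definition all_num : M -> Prop := fun _ => True.

Definition prod (A B : M -> Prop) : M -> Prop :=
  fun p => exists x y : M, p = pair x y /\ A x /\ B y.

Definition is_partial_function (A B F : M -> Prop) : Prop :=
  (forall p : M, F p -> prod A B p) /\
  (forall x y z : M, F (pair x y) -> F (pair x z) -> y = z).

Definition is_function (A B F : M -> Prop) : Prop :=
  is_partial_function A B F /\
  (forall x : M, A x -> exists y : M, F (pair x y)).

(** * CSC spaces

    [U] codes the sequence of basic open sets and [k] is the graph of a partial
    function on triples. *)

Record is_CSC_space (X U k : M -> Prop) : Prop := {
  CSC_subset : forall i x : M, section U i x -> X x;
  CSC_cover : forall x : M, X x -> exists i : M, section U i x;
  CSC_fun : is_partial_function (prod (prod X all_num) all_num) all_num k;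
  CSC_inter : forall x i j : M, section U i x -> section U j x ->
    exists l : M, k (pair (pair (pair x i) j) l) /\
      section U l x /\
      (forall y : M, section U l y -> section U i y /\ section U j y)
}.

(** [x] is an isolated point of the subspace [Y]. *)
Definition isolated_in (U Y : M -> Prop) (x : M) : Prop :=
  Y x /\ exists i : M, section U i x /\
           (forall y : M, section U i y -> Y y -> y = x).

Definition scattered (X U : M -> Prop) : Prop :=
  forall Y : nset M,
    (forall x : M, Y x -> X x) ->
    (exists x : M, Y x) ->
    exists x : M, isolated_in U Y x.

(** * Rational and real numbers

    [Rat a b c] stands for (a - b) / (c + 1), so that a rational has several
    codes and the order below compares values. *)

Record rat : Type := Rat { rpos : M; rneg : M; rden : M }.

Definition rat_code (q : rat) : M := pair (pair (rpos q) (rneg q)) (rden q).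

Definition is_rat_code (n : M) : Prop := exists q : rat, n = rat_code q.

Definition rat0 : rat := Rat 0 0 0.

Definition rat_le (p q : rat) : Prop :=
  rpos p * (rden q + 1) + rneg q * (rden p + 1)
    <= rpos q * (rden p + 1) + rneg p * (rden q + 1).

Definition rat_lt (p q : rat) : Prop := ~ rat_le q p.

(** The last component is (c + 1) * (c' + 1) - 1. *)
Definition rat_add (p q : rat) : rat :=
  Rat (rpos p * (rden q + 1) + rpos q * (rden p + 1))
      (rneg p * (rden q + 1) + rneg q * (rden p + 1))
      (rden p * rden q + rden p + rden q).

Definition rat_opp (p : rat) : rat := Rat (rneg p) (rpos p) (rden p).

Definition rat_dist_le (p q e : rat) : Prop :=
  let r := rat_add p (rat_opp q) in rat_le r e /\ rat_le (rat_opp r) e.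

(** [m] is the [k]-th power of 2, defined by primitive recursion. *)
Definition is_pow2 (k m : M) : Prop :=
  exists F : nset M,
    is_function all_num all_num F /\
    F (pair 0 1) /\
    (forall j v : M, F (pair j v) -> F (pair (j + 1) (v + v))) /\
    F (pair k m).

(** [e] is 2 to the power -[k]. *)
Definition is_inv_pow2 (k : M) (e : rat) : Prop :=
  exists c : M, is_pow2 k (c + 1) /\ e = Rat 1 0 c.

(** Sequences of rationals, as functional relations; a real number is such a
    sequence that is [rapid].  The order, equality and sum are the usual ones on
    such codes: q <= q' iff q_k <= q'_k + 2^(-k+1) for every k, q = q' iff
    |q_k - q'_k| <= 2^(-k+1) for every k, and (q + q')_k = q_(k+1) + q'_(k+1). *)
Definition ratseq : Type := M -> rat -> Prop.

Definition rapid (r : ratseq) : Prop :=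
  forall (k i : M) (p q e : rat),
    r k p -> r (k + i) q -> is_inv_pow2 k e -> rat_dist_le p q e.

Definition real_le (r s : ratseq) : Prop :=
  forall (k : M) (p q e : rat),
    r k p -> s k q -> is_inv_pow2 k e -> rat_le p (rat_add q (rat_add e e)).

Definition real_lt (r s : ratseq) : Prop := ~ real_le s r.

Definition real_eq (r s : ratseq) : Prop :=
  forall (k : M) (p q e : rat),
    r k p -> s k q -> is_inv_pow2 k e -> rat_dist_le p q (rat_add e e).

Definition real_add (r s : ratseq) : ratseq :=
  fun k q => exists p p' : rat,
    r (k + 1) p /\ s (k + 1) p' /\ q = rat_add p p'.

Definition real_of_rat (q : rat) : ratseq := fun _ p => p = q.

(** * Countable metric spaces

    A real-valued function on X * X is coded by a rational-valued function on
    X * X * N whose value at every (x, y) is a real number. *)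

Definition dist (d : M -> Prop) (x y : M) : ratseq :=
  fun k q => d (pair (pair (pair x y) k) (rat_code q)).

Record is_metric_space (X d : M -> Prop) : Prop := {
  metric_fun : is_function (prod (prod X X) all_num) is_rat_code d;
  metric_real : forall x y : M, X x -> X y -> rapid (dist d x y);
  metric_ge0 : forall x y : M, X x -> X y ->
    real_le (real_of_rat rat0) (dist d x y);
  metric_eq0 : forall x y : M, X x -> X y ->
    (real_eq (dist d x y) (real_of_rat rat0) <-> x = y);
  metric_sym : forall x y : M, X x -> X y ->
    real_eq (dist d x y) (dist d y x);
  metric_triangle : forall x y z : M, X x -> X y -> X z ->
    real_le (dist d x z) (real_add (dist d x y) (dist d y z))
}.

(** [a] is the graph of a sequence of points. *)
Definition cauchy (d a : M -> Prop) : Prop :=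
  forall e : rat, rat_lt rat0 e ->
    exists n0 : M, forall m n x y : M, n0 <= m -> n0 <= n ->
      a (pair m x) -> a (pair n y) -> real_lt (dist d x y) (real_of_rat e).

Definition converges_to (d a : M -> Prop) (x : M) : Prop :=
  forall e : rat, rat_lt rat0 e ->
    exists n0 : M, forall n y : M, n0 <= n ->
      a (pair n y) -> real_lt (dist d y x) (real_of_rat e).

Definition complete (X d : M -> Prop) : Prop :=
  forall a : nset M, is_function all_num X a -> cauchy d a ->
    exists x : M, X x /\ converges_to d a x.

End Coding.

(** A sequence of spaces is given by one set for each component, whose [i]-th
    section is that component of the [i]-th space. *)

Definition scattered_index_set_exists (M : L2structure) : Prop :=
  forall X U k : nset M,
    (forall i : M, is_CSC_space (section X i) (section U i) (section k i)) ->
    exists Z : nset M, forall i : M,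
      Z i <-> scattered (section X i) (section U i).

Definition complete_index_set_exists (M : L2structure) : Prop :=
  forall X d : nset M,
    (forall i : M, is_metric_space (section X i) (section d i)) ->
    exists Z : nset M, forall i : M,
      Z i <-> complete (section X i) (section d i).

(* Main.v *)
(** Both index sets are Pi^1_1-definable, which gives the direct implications.
    (A set of codes for the graph of 2^k is needed to bring the definition of
    completeness into Pi^1_1 form.)

    Conversely, each of the two principles, applied to the initial segments of
    the natural numbers, yields Sigma^0_1 comprehension: an initial segment is
    infinite exactly if it is not scattered in the topology of its final
    segments, and not complete for the ultrametric in which distinct x, y have
    distance 1 / (min (x, y) + 1).  Now let theta (n, X) be arithmetical.
    Introducing propositional variables for the truth values of all instances of
    all subformulas (Tseitin's transformation) turns "there is X with
    theta (n, X)" into the satisfiability of a countable family of infinitary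
    clauses.  In the set of finite strings, consider the order in which a proper
    extension of s lies above s if it makes true all the clauses with index at
    most |s|.  The satisfying assignments are the limits of strictly increasing
    sequences, so that there is one exactly if the Alexandrov topology of this
    order is not scattered.  Likewise, call two strings b-close if they have a
    common initial segment of length at least b that makes the first b clauses
    true; in the ultrametric given by this relation the Cauchy sequences without
    a limit are those which converge to a satisfying assignment. *)

From Stdlib Require Import Classical FunctionalExtensionality Lia Ring.
Require Import Defs.

Set Implicit Arguments.
Unset Strict Implicit.
Unset Printing Implicit Defensive.
Local Open Scope l2_scope.

(** * Definable predicates *)

(** Only Sigma^0_1 induction and Delta^0_1 comprehension are at hand inside [M]. Hence predicates
    are carried together with a defining formula, witnesses are bounded wherever possible, and
    finite sets and computations are coded by numbers of [M]. Formulas stay external: a formula has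
    standardly many subformulas, so the Tseitin variables fall into standardly many groups (tags),
    and the truth values of each new group come from the earlier ones by Sigma^0_1 comprehension.
    This is why that weaker principle is extracted first; it is needed again to read off a set from
    a chain or a Cauchy sequence of strings. Clauses are used because the literal that makes a
    clause true is decided by a finite part of the assignment, which strings can approximate. The
    length of a string serves as a counter: by asking an extension of [s] to satisfy all clauses up
    to the length of [s], every clause gets its turn along an infinite chain. *)

Definition lift (r : nat -> nat) (i : nat) : nat :=
  match i with O => O | S j => S (r j) end.

Fixpoint ren_term (r : nat -> nat) (t : term) : term :=
  match t with
  | TVar i => TVar (r i)
  | TZero => TZero
  | TOne => TOne
  | TAdd t u => TAdd (ren_term r t) (ren_term r u)
  | TMul t u => TMul (ren_term r t) (ren_term r u)
  end.

Fixpoint ren (r q : nat -> nat) (f : formula) : formula :=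
  match f with
  | FEq t u => FEq (ren_term r t) (ren_term r u)
  | FLt t u => FLt (ren_term r t) (ren_term r u)
  | FMem t X => FMem (ren_term r t) (q X)
  | FNot f => FNot (ren r q f)
  | FAnd f g => FAnd (ren r q f) (ren r q g)
  | FOr f g => FOr (ren r q f) (ren r q g)
  | FImp f g => FImp (ren r q f) (ren r q g)
  | FBAll t f => FBAll (ren_term r t) (ren (lift r) q f)
  | FBEx t f => FBEx (ren_term r t) (ren (lift r) q f)
  | FAll f => FAll (ren (lift r) q f)
  | FEx f => FEx (ren (lift r) q f)
  | FSetAll f => FSetAll (ren r (lift q) f)
  | FSetEx f => FSetEx (ren r (lift q) f)
  end.

Lemma scons_lift (T : Type) (x : T) (e : nat -> T) (r : nat -> nat) :
  (fun i => scons x e (lift r i)) = scons x (fun i => e (r i)).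
Proof. apply functional_extensionality; intros [|i]; reflexivity. Qed.

Lemma eval_ren (M : L2structure) (r : nat -> nat) (t : term) (e : nat -> M) :
  eval e (ren_term r t) = eval (fun i => e (r i)) t.
Proof. induction t; simpl; congruence. Qed.

Lemma sat_ren (M : L2structure) (f : formula) :
  forall (r q : nat -> nat) (e : nat -> M) (s : nat -> nset M),
    sat e s (ren r q f) <-> sat (fun i => e (r i)) (fun i => s (q i)) f.
Proof.
  induction f; intros r q e s; simpl; rewrite ?eval_ren; try tauto;
    try (rewrite IHf; tauto); try (rewrite IHf1, IHf2; tauto);
    (split; intros H);
    try (intros n Hn; specialize (H n Hn); rewrite IHf, scons_lift in *; exact H);
    try (intros n; specialize (H n); rewrite IHf, scons_lift in *; exact H);
    try (destruct H as [n [Hn H]]; exists n; rewrite IHf, scons_lift in *; tauto);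
    try (destruct H as [n H]; exists n; rewrite IHf, scons_lift in *; tauto).
Qed.

(** Merges two parameter lists: a formula renamed by [evn] reads the first list and one renamed by
    [odd] the second, so formulas with unrelated parameters can be joined by a connective. *)
Fixpoint inter (T : Type) (e1 e2 : nat -> T) (i : nat) : T :=
  match i with
  | O => e1 O
  | S O => e2 O
  | S (S i) => inter (fun j => e1 (S j)) (fun j => e2 (S j)) i
  end.

Definition evn (i : nat) : nat := i + i.
Definition odd (i : nat) : nat := S (i + i).

Lemma inter_evn (T : Type) (i : nat) : forall e1 e2 : nat -> T,
  inter e1 e2 (evn i) = e1 i.
Proof.
  unfold evn; induction i as [|i IH]; intros e1 e2; [reflexivity|].
  replace (S i + S i)%nat with (S (S (i + i))) by lia; simpl; apply IH.
Qed.

Lemma inter_odd (T : Type) (i : nat) : forall e1 e2 : nat -> T,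
  inter e1 e2 (odd i) = e2 i.
Proof.
  unfold odd; induction i as [|i IH]; intros e1 e2; [reflexivity|].
  replace (S i + S i)%nat with (S (S (i + i))) by lia.
  exact (IH (fun j => e1 (S j)) (fun j => e2 (S j))).
Qed.

Fixpoint glue (T : Type) (N : nat) (e p : nat -> T) : nat -> T :=
  match N with
  | O => p
  | S N => scons (e O) (glue N (fun i => e (S i)) p)
  end.

Lemma glue_lt (T : Type) (N : nat) : forall (e p : nat -> T) (i : nat),
  (i < N)%nat -> glue N e p i = e i.
Proof.
  induction N as [|N IH]; intros e p i Hi; [lia|].
  destruct i as [|i]; simpl; [reflexivity|]. now rewrite IH by lia.
Qed.

Lemma glue_ge (T : Type) (N : nat) : forall (e p : nat -> T) (i : nat),
  glue N e p (N + i) = p i.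
Proof. induction N as [|N IH]; intros e p i; simpl; auto. Qed.

Fixpoint lifts (N : nat) (r : nat -> nat) : nat -> nat :=
  match N with O => r | S N => lift (lifts N r) end.

Lemma glue_lifts (T : Type) (N : nat) (r : nat -> nat) : forall e p : nat -> T,
  (fun i => glue N e p (lifts N r i)) = glue N e (fun i => p (r i)).
Proof.
  induction N as [|N IH]; intros e p; simpl; [reflexivity|].
  now rewrite scons_lift, IH.
Qed.

Lemma glue_inter_l (T : Type) (N : nat) (e p1 p2 : nat -> T) :
  (fun i => glue N e (inter p1 p2) (lifts N evn i)) = glue N e p1.
Proof.
  rewrite glue_lifts; f_equal; apply functional_extensionality; intros i.
  apply inter_evn.
Qed.

Lemma glue_inter_r (T : Type) (N : nat) (e p1 p2 : nat -> T) :
  (fun i => glue N e (inter p1 p2) (lifts N odd i)) = glue N e p2.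
Proof.
  rewrite glue_lifts; f_equal; apply functional_extensionality; intros i.
  apply inter_odd.
Qed.

Lemma scons_inter_l (T : Type) (Y : T) (p1 p2 : nat -> T) :
  (fun i => scons Y (inter p1 p2) (lift evn i)) = scons Y p1.
Proof.
  rewrite scons_lift; f_equal; apply functional_extensionality; intros i.
  apply inter_evn.
Qed.

Lemma scons_inter_r (T : Type) (Y : T) (p1 p2 : nat -> T) :
  (fun i => scons Y (inter p1 p2) (lift odd i)) = scons Y p2.
Proof.
  rewrite scons_lift; f_equal; apply functional_extensionality; intros i.
  apply inter_odd.
Qed.

(** What [Sigma00] and [arithmetical] have in common, so that the closure properties of [rep] are
    proved once for both. Unbounded number quantifiers are treated apart, for [arithmetical]
    alone. *)
Record formula_class (C : formula -> Prop) : Prop := {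
  class_ren : forall r q f, C f -> C (ren r q f);
  class_eq : forall t u, C (FEq t u);
  class_lt : forall t u, C (FLt t u);
  class_mem : forall t X, C (FMem t X);
  class_not : forall f, C f -> C (FNot f);
  class_and : forall f g, C f -> C g -> C (FAnd f g);
  class_or : forall f g, C f -> C g -> C (FOr f g);
  class_imp : forall f g, C f -> C g -> C (FImp f g);
  class_ball : forall t f, C f -> C (FBAll t f);
  class_bex : forall t f, C f -> C (FBEx t f)
}.

Lemma Sigma00_class : formula_class Sigma00.
Proof.
  split; simpl; auto.
  intros r q f; revert r q; induction f; simpl; intros r q; intuition.
Qed.

Lemma arithmetical_class : formula_class arithmetical.
Proof.
  split; simpl; auto.
  intros r q f; revert r q; induction f; simpl; intros r q; intuition.
Qed.

(* [rep C N P]: the predicate [P], of the first [N] entries of a list of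
   numbers and of one set, is defined by a formula of the class [C] with number
   and set parameters from [M]. *)

Section Representable.
Variable M : L2structure.

Definition trep (N : nat) (x : (nat -> M) -> M) : Prop :=
  exists (t : term) (p : nat -> M), forall e, eval (glue N e p) t = x e.

Definition rep (C : formula -> Prop) (N : nat)
    (P : (nat -> M) -> nset M -> Prop) : Prop :=
  exists (f : formula) (p : nat -> M) (s : nat -> nset M), C f /\
    forall e Y, sat (glue N e p) (scons Y s) f <-> P e Y.


Lemma trep_var N i : (i < N)%nat -> trep N (fun e => e i).
Proof. intros Hi; exists (TVar i), (fun _ => 0); intros e; now apply glue_lt. Qed.

Lemma trep_const N (c : M) : trep N (fun _ => c).
Proof.
  exists (TVar (N + 0)), (fun _ => c); intros e. exact (glue_ge N e (fun _ => c) 0).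
Qed.

Lemma trep_merge N x y : trep N x -> trep N y ->
  exists t u p, forall e, eval (glue N e p) t = x e /\ eval (glue N e p) u = y e.
Proof.
  intros [t [p1 H1]] [u [p2 H2]].
  exists (ren_term (lifts N evn) t), (ren_term (lifts N odd) u), (inter p1 p2).
  intros e; rewrite !eval_ren, glue_inter_l, glue_inter_r; auto.
Qed.

Lemma trep_add N x y : trep N x -> trep N y -> trep N (fun e => x e + y e).
Proof.
  intros Hx Hy; destruct (trep_merge Hx Hy) as [t [u [p H]]].
  exists (TAdd t u), p; intros e; simpl; destruct (H e); congruence.
Qed.

Lemma trep_mul N x y : trep N x -> trep N y -> trep N (fun e => x e * y e).
Proof.
  intros Hx Hy; destruct (trep_merge Hx Hy) as [t [u [p H]]].
  exists (TMul t u), p; intros e; simpl; destruct (H e); congruence.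
Qed.

Lemma trep_pair N x y : trep N x -> trep N y -> trep N (fun e => pair (x e) (y e)).
Proof. intros Hx Hy; unfold pair; repeat apply trep_add || apply trep_mul; auto. Qed.

Variable C : formula -> Prop.
Hypothesis HC : formula_class C.

Lemma rep_iff N P Q : (forall e Y, P e Y <-> Q e Y) -> rep C N P -> rep C N Q.
Proof.
  intros H [f [p [s [Cf Hf]]]]; exists f, p, s; split; auto.
  intros e Y; now rewrite Hf, H.
Qed.

Lemma rep_eq N x y : trep N x -> trep N y -> rep C N (fun e _ => x e = y e).
Proof.
  intros Hx Hy; destruct (trep_merge Hx Hy) as [t [u [p H]]].
  destruct (nset_inhabited M) as [Z].
  exists (FEq t u), p, (fun _ => Z); split; [now apply class_eq|].
  intros e Y; simpl; destruct (H e) as [-> ->]; tauto.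
Qed.

Lemma rep_lt N x y : trep N x -> trep N y -> rep C N (fun e _ => x e < y e).
Proof.
  intros Hx Hy; destruct (trep_merge Hx Hy) as [t [u [p H]]].
  destruct (nset_inhabited M) as [Z].
  exists (FLt t u), p, (fun _ => Z); split; [now apply class_lt|].
  intros e Y; simpl; destruct (H e) as [-> ->]; tauto.
Qed.

Lemma rep_mem N (A : nset M) x : trep N x -> rep C N (fun e _ => A (x e)).
Proof.
  intros [t [p H]].
  (* Set variable 0 is the distinguished set, so the parameter [A] has index 1. *)
  exists (FMem t 1), p, (fun _ => A); split; [now apply class_mem|].
  intros e Y; simpl; now rewrite H.
Qed.

Lemma rep_memv N x : trep N x -> rep C N (fun e Y => Y (x e)).
Proof.
  intros [t [p H]]; destruct (nset_inhabited M) as [Z].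
  exists (FMem t 0), p, (fun _ => Z); split; [now apply class_mem|].
  intros e Y; simpl; now rewrite H.
Qed.

Lemma rep_not N P : rep C N P -> rep C N (fun e Y => ~ P e Y).
Proof.
  intros [f [p [s [Cf Hf]]]]; exists (FNot f), p, s; split.
  - now apply class_not.
  - intros e Y; simpl; now rewrite Hf.
Qed.

Lemma rep_merge N P Q : rep C N P -> rep C N Q ->
  exists f g p s, C f /\ C g /\
    forall e Y, (sat (glue N e p) (scons Y s) f <-> P e Y) /\
                (sat (glue N e p) (scons Y s) g <-> Q e Y).
Proof.
  intros [f [p1 [s1 [Cf Hf]]]] [g [p2 [s2 [Cg Hg]]]].
  exists (ren (lifts N evn) (lift evn) f), (ren (lifts N odd) (lift odd) g),
    (inter p1 p2), (inter s1 s2).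
  split; [now apply class_ren|]; split; [now apply class_ren|].
  intros e Y; rewrite !sat_ren.
  rewrite glue_inter_l, glue_inter_r, scons_inter_l, scons_inter_r; auto.
Qed.

Lemma rep_and N P Q : rep C N P -> rep C N Q -> rep C N (fun e Y => P e Y /\ Q e Y).
Proof.
  intros HP HQ; destruct (rep_merge HP HQ) as [f [g [p [s [Cf [Cg H]]]]]].
  exists (FAnd f g), p, s; split; [now apply class_and|].
  intros e Y; simpl; destruct (H e Y); tauto.
Qed.

Lemma rep_or N P Q : rep C N P -> rep C N Q -> rep C N (fun e Y => P e Y \/ Q e Y).
Proof.
  intros HP HQ; destruct (rep_merge HP HQ) as [f [g [p [s [Cf [Cg H]]]]]].
  exists (FOr f g), p, s; split; [now apply class_or|].
  intros e Y; simpl; destruct (H e Y); tauto.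
Qed.

Lemma rep_imp N P Q : rep C N P -> rep C N Q -> rep C N (fun e Y => P e Y -> Q e Y).
Proof.
  intros HP HQ; destruct (rep_merge HP HQ) as [f [g [p [s [Cf [Cg H]]]]]].
  exists (FImp f g), p, s; split; [now apply class_imp|].
  intros e Y; simpl; destruct (H e Y); tauto.
Qed.

Lemma rep_equiv N P Q : rep C N P -> rep C N Q -> rep C N (fun e Y => P e Y <-> Q e Y).
Proof. intros HP HQ; apply rep_and; apply rep_imp; auto. Qed.

Lemma rep_True N : rep C N (fun _ _ => True).
Proof.
  apply (@rep_iff N (fun _ _ => @zero M = 0)); [tauto|].
  apply rep_eq; apply trep_const.
Qed.

Lemma rep_bound N x (Q : (nat -> M) -> M -> nset M -> Prop) :
  trep N x -> rep C (S N) (fun e Y => Q (fun i => e (S i)) (e O) Y) ->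
  exists t f p s, C f /\ forall e Y, eval (glue N e p) t = x e /\
    forall n, sat (scons n (glue N e p)) (scons Y s) f <-> Q e n Y.
Proof.
  intros [t [p1 Ht]] [f [p2 [s [Cf Hf]]]].
  exists (ren_term (lifts N evn) t), (ren (lifts (S N) odd) (fun i => i) f), (inter p1 p2), s.
  split; [now apply class_ren|].
  intros e Y; split; [now rewrite eval_ren, glue_inter_l|].
  intros n; change (scons n (glue N e (inter p1 p2)))
    with (glue (S N) (scons n e) (inter p1 p2)).
  rewrite sat_ren, glue_inter_r; apply Hf.
Qed.

Lemma rep_ball N x (Q : (nat -> M) -> M -> nset M -> Prop) :
  trep N x -> rep C (S N) (fun e Y => Q (fun i => e (S i)) (e O) Y) ->
  rep C N (fun e Y => forall n, n < x e -> Q e n Y).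
Proof.
  intros Hx HQ; destruct (rep_bound Hx HQ) as [t [f [p [s [Cf H]]]]].
  exists (FBAll t f), p, s; split; [now apply class_ball|].
  intros e Y; simpl; destruct (H e Y) as [-> H1]; split; intros H2 n Hn; apply H1; auto.
Qed.

Lemma rep_bex N x (Q : (nat -> M) -> M -> nset M -> Prop) :
  trep N x -> rep C (S N) (fun e Y => Q (fun i => e (S i)) (e O) Y) ->
  rep C N (fun e Y => exists n, n < x e /\ Q e n Y).
Proof.
  intros Hx HQ; destruct (rep_bound Hx HQ) as [t [f [p [s [Cf H]]]]].
  exists (FBEx t f), p, s; split; [now apply class_bex|].
  intros e Y; simpl; destruct (H e Y) as [-> H1]; split; intros [n [Hn H2]];
    exists n; split; auto; now apply H1.
Qed.

Lemma glue_weaken (T : Type) (N : nat) : forall e p : nat -> T,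
  (fun i => glue (S N) e p (lifts N S i)) = glue N e p.
Proof.
  induction N as [|N IH]; intros e p; [reflexivity|].
  change (lifts (S N) S) with (lift (lifts N S)).
  change (glue (S (S N)) e p) with (scons (e O) (glue (S N) (fun i => e (S i)) p)).
  now rewrite scons_lift, IH.
Qed.

Lemma rep_weaken N P : rep C N P -> rep C (S N) P.
Proof.
  intros [f [p [s [Cf H]]]]; exists (ren (lifts N S) (fun i => i) f), p, s.
  split; [now apply class_ren|].
  intros e Y; rewrite sat_ren, glue_weaken; apply H.
Qed.

End Representable.

Lemma rep_all (M : L2structure) N (Q : (nat -> M) -> M -> nset M -> Prop) :
  rep arithmetical (S N) (fun e Y => Q (fun i => e (S i)) (e O) Y) ->
  rep arithmetical N (fun e Y => forall n, Q e n Y).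
Proof.
  intros [f [p [s [Cf H]]]]; exists (FAll f), p, s; split; [exact Cf|].
  intros e Y; simpl; split; intros H1 n; now apply (H (scons n e) Y), H1.
Qed.

Lemma rep_ex (M : L2structure) N (Q : (nat -> M) -> M -> nset M -> Prop) :
  rep arithmetical (S N) (fun e Y => Q (fun i => e (S i)) (e O) Y) ->
  rep arithmetical N (fun e Y => exists n, Q e n Y).
Proof.
  intros [f [p [s [Cf H]]]]; exists (FEx f), p, s; split; [exact Cf|].
  intros e Y; simpl; split; intros [n H1]; exists n; now apply (H (scons n e) Y).
Qed.

(** * Comprehension, induction and arithmetic *)

Existing Class RCA0.

Ltac solve_trep :=
  lazymatch goal with
  | |- trep _ (fun e => e ?i) => apply trep_var; lia
  | |- trep _ (fun _ => ?c) => apply trep_const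
  | |- trep _ (fun e => add _ _) => apply trep_add; solve_trep
  | |- trep _ (fun e => mul _ _) => apply trep_mul; solve_trep
  | |- trep _ (fun e => pair _ _) => apply trep_pair; solve_trep
  end.

Ltac rep_class := first [exact Sigma00_class | exact arithmetical_class].

(** Recursion on the shape of the predicate. Bounded quantifiers are matched before unbounded ones,
    since the latter are available only for [arithmetical]. Predicates of unknown shape are left as
    goals. *)
Ltac definable :=
  cbv beta;
  lazymatch goal with
  | |- rep _ _ (fun e Y => _ /\ _) => apply rep_and; [rep_class | definable | definable]
  | |- rep _ _ (fun e Y => _ \/ _) => apply rep_or; [rep_class | definable | definable]
  | |- rep _ _ (fun e Y => ~ _) => apply rep_not; [rep_class | definable]
  | |- rep _ _ (fun e Y => _ <-> _) => apply rep_equiv; [rep_class | definable | definable]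
  | |- rep _ _ (fun e Y => True) => apply rep_True; rep_class
  | |- rep _ _ (fun e Y => @eq (num _) _ _) => apply rep_eq; [rep_class | solve_trep | solve_trep]
  | |- rep _ _ (fun e Y => lt _ _) => apply rep_lt; [rep_class | solve_trep | solve_trep]
  | |- rep _ _ (fun e Y => elts Y _) => apply rep_memv; [rep_class | solve_trep]
  | |- rep _ _ (fun e Y => elts _ _) => apply rep_mem; [rep_class | solve_trep]
  | |- rep ?K ?k (fun e Y => forall n, lt n (@?t e) -> @?R e n Y) =>
      apply (@rep_ball _ K) with (N := k) (x := t) (Q := R); [rep_class | solve_trep | definable]
  | |- rep ?K ?k (fun e Y => exists n, lt n (@?t e) /\ @?R e n Y) =>
      apply (@rep_bex _ K) with (N := k) (x := t) (Q := R); [rep_class | solve_trep | definable]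
  | |- rep _ ?k (fun e Y => forall n : num _, @?R e n Y) =>
      apply rep_all with (N := k) (Q := R); definable
  | |- rep _ ?k (fun e Y => exists n : num _, @?R e n Y) =>
      apply rep_ex with (N := k) (Q := R); definable
  | |- rep _ _ (fun e Y => forall q : rat _, _) => idtac
  | |- rep _ _ (fun e Y => _ -> _) => apply rep_imp; [rep_class | definable | definable]
  | |- _ => idtac
  end.

Section Schemes.
Context {M : L2structure} {HM : RCA0 M}.

Lemma comprehension (P : M -> Prop) :
  rep Sigma00 1 (fun e _ => P (e O)) -> exists X : nset M, forall n, X n <-> P n.
Proof.
  intros [f [p [s [Cf H]]]]; destruct (nset_inhabited M) as [Z].
  (* The formula is shifted past a dummy variable, over which [FEx] and [FAll] then agree. *)
  assert (E : forall n m, sat (scons m (scons n p)) (scons Z s) (ren S (fun i => i) f) <-> P n).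
  { intros n m; rewrite sat_ren; exact (H (fun _ => n) Z). }
  destruct (RCA0_comprehension HM) with
    (f := FEx (ren S (fun i => i) f)) (g := FAll (ren S (fun i => i) f))
    (e := p) (s := scons Z s) as [X HX].
  - eexists; split; [|reflexivity]; now apply Sigma00_class.
  - eexists; split; [|reflexivity]; now apply Sigma00_class.
  - intros n; simpl; split.
    + intros [m Hm] m'; rewrite E in *; auto.
    + intros Hm; exists 0; auto.
  - exists X; intros n; rewrite HX; simpl; split.
    + intros [m Hm]; rewrite E in Hm; auto.
    + exists 0; now rewrite E.
Qed.

Lemma Delta_comprehension (P Q : M -> M -> Prop) :
  rep Sigma00 2 (fun e _ => P (e 1%nat) (e O)) ->
  rep Sigma00 2 (fun e _ => Q (e 1%nat) (e O)) ->
  (forall n, (exists m, P n m) <-> (forall m, Q n m)) ->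
  exists X : nset M, forall n, X n <-> exists m, P n m.
Proof.
  intros HP HQ HPQ; destruct (rep_merge Sigma00_class HP HQ) as [f [g [p [s [Cf [Cg H]]]]]].
  destruct (nset_inhabited M) as [Z].
  pose proof (fun n m => H (scons m (fun _ => n)) Z) as E; simpl in E.
  destruct (RCA0_comprehension HM) with (f := FEx f) (g := FAll g) (e := p) (s := scons Z s)
    as [X HX].
  - eexists; split; [|reflexivity]; auto.
  - eexists; split; [|reflexivity]; auto.
  - intros n; simpl; split.
    + intros [m Hm] m'; apply E. apply (HPQ n). exists m; now apply E.
    + intros Hm; destruct (proj2 (HPQ n)) as [m Hm']; [intros m; apply E; auto|].
      exists m; now apply E.
  - exists X; intros n; rewrite HX; simpl; split; intros [m Hm]; exists m; now apply E.
Qed.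

Lemma Sigma_induction (P : M -> M -> Prop) :
  rep Sigma00 2 (fun e _ => P (e 1%nat) (e O)) ->
  (exists m, P 0 m) -> (forall n, (exists m, P n m) -> exists m, P (n + 1) m) ->
  forall n, exists m, P n m.
Proof.
  intros [f [p [s [Cf H]]]] H0 HS; destruct (nset_inhabited M) as [Z].
  pose proof (fun n m => H (scons m (fun _ => n)) Z) as E; simpl in E.
  assert (E' : forall n, sat (scons n p) (scons Z s) (FEx f) <-> exists m, P n m).
  { intros n; simpl; split; intros [m Hm]; exists m; now apply E. }
  intros n; apply E'.
  apply (RCA0_induction HM).
  - exists f; auto.
  - now apply E'.
  - intros k Hk; apply E', HS, E', Hk.
Qed.

Lemma induction (P : M -> Prop) :
  rep Sigma00 1 (fun e _ => P (e O)) ->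
  P 0 -> (forall n, P n -> P (n + 1)) -> forall n, P n.
Proof.
  intros HP H0 HS n.
  destruct (comprehension HP) as [X HX].
  destruct (@Sigma_induction (fun n _ => X n)) with (n := n) as [_ H].
  - definable.
  - exists 0; now apply HX.
  - intros k [_ Hk]; exists 0; apply HX, HS, HX, Hk.
  - now apply HX.
Qed.

End Schemes.

Ltac induct := lazymatch goal with |- forall n, @?P n => apply (@induction _ _ P) end.

Section Arithmetic.
Context {M : L2structure} {HM : RCA0 M}.
Implicit Types a b c d m n x y z : M.

Lemma add_0_l n : 0 + n = n.
Proof.
  revert n; induct; [definable | apply (add_0 (RCA0_basic HM))|].
  intros n IH; now rewrite (add_succ (RCA0_basic HM)), IH.
Qed.

Lemma add_succ_l m n : (m + 1) + n = (m + n) + 1.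
Proof.
  revert n; induct; [definable | now rewrite !(add_0 (RCA0_basic HM))|].
  intros n IH; now rewrite !(add_succ (RCA0_basic HM)), IH.
Qed.

Lemma add_comm m n : m + n = n + m.
Proof.
  revert n; induct.
  - definable.
  - now rewrite (add_0 (RCA0_basic HM)), add_0_l.
  - intros n IH; now rewrite (add_succ (RCA0_basic HM)), add_succ_l, IH.
Qed.

Lemma add_assoc m n k : m + (n + k) = (m + n) + k.
Proof.
  revert k; induct; [definable | now rewrite !(add_0 (RCA0_basic HM))|].
  intros k IH; now rewrite !(add_succ (RCA0_basic HM)), IH.
Qed.

Lemma mul_0_l n : 0 * n = 0.
Proof.
  revert n; induct; [definable | apply (mul_0 (RCA0_basic HM))|].
  intros n IH; now rewrite (mul_succ (RCA0_basic HM)), IH, (add_0 (RCA0_basic HM)).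
Qed.

Lemma mul_succ_l m n : (m + 1) * n = m * n + n.
Proof.
  revert n; induct.
  - definable.
  - now rewrite !(mul_0 (RCA0_basic HM)), (add_0 (RCA0_basic HM)).
  - intros n IH; rewrite !(mul_succ (RCA0_basic HM)), IH.
    rewrite !(add_succ (RCA0_basic HM)), <- !(add_assoc (m * n)).
    now rewrite (add_comm n m).
Qed.

Lemma mul_comm m n : m * n = n * m.
Proof.
  revert n; induct.
  - definable.
  - now rewrite (mul_0 (RCA0_basic HM)), mul_0_l.
  - intros n IH; now rewrite (mul_succ (RCA0_basic HM)), mul_succ_l, IH.
Qed.

Lemma mul_add_r m n k : m * (n + k) = m * n + m * k.
Proof.
  revert k; induct; [definable | now rewrite (mul_0 (RCA0_basic HM)), !(add_0 (RCA0_basic HM))|].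
  intros k IH; now rewrite !(add_succ (RCA0_basic HM)), !(mul_succ (RCA0_basic HM)), IH, add_assoc.
Qed.

Lemma mul_assoc m n k : m * (n * k) = (m * n) * k.
Proof.
  revert k; induct; [definable | now rewrite !(mul_0 (RCA0_basic HM))|].
  intros k IH; now rewrite !(mul_succ (RCA0_basic HM)), mul_add_r, IH.
Qed.

Lemma mul_1_l n : 1 * n = n.
Proof.
  rewrite mul_comm, <- (add_0_l 1), (mul_succ (RCA0_basic HM)).
  now rewrite (mul_0 (RCA0_basic HM)), add_0_l.
Qed.

Lemma semiring : @semi_ring_theory M 0 1 add mul eq.
Proof.
  split; auto using add_0_l, add_comm, add_assoc, mul_1_l, mul_0_l, mul_comm, mul_assoc.
  intros m n k; now rewrite mul_comm, mul_add_r, !(mul_comm k).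
Qed.

Add Ring M_ring : semiring.

(** Case analysis obtained from Sigma^0_1 induction; the step ignores its hypothesis. *)
Lemma zero_or_succ n : n = 0 \/ exists m, n = m + 1.
Proof.
  destruct (@Sigma_induction M HM (fun n m => n = 0 \/ n = m + 1)) with (n := n) as [m Hm].
  - definable.
  - exists 0; auto.
  - intros k _; exists k; auto.
  - destruct Hm; eauto.
Qed.

Lemma add_cancel_r m n k : m + k = n + k -> m = n.
Proof.
  revert k; induct; [definable | now rewrite !(add_0 (RCA0_basic HM))|].
  intros k IH; rewrite !(add_succ (RCA0_basic HM)); intros H.
  now apply IH, (succ_inj (RCA0_basic HM)).
Qed.

Lemma add_cancel_l m n k : k + m = k + n -> m = n.
Proof. rewrite !(add_comm k); apply add_cancel_r. Qed.

(** Turns inequalities into equations, so that most order facts reduce to [ring]. *)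
Lemma lt_iff m n : m < n <-> exists d, n = m + d + 1.
Proof.
  split.
  - intros H.
    (* With [m < n] placed inside the matrix, the induction formula is Sigma^0_1. *)
    destruct (@Sigma_induction M HM (fun n d => m < n -> n = m + d + 1)) with (n := n) as [d Hd].
    + definable.
    + exists 0; intros H0; now apply (lt_0 (RCA0_basic HM)) in H0.
    + intros k [d Hd].
      destruct (classic (m = k)) as [<- | Hk].
      * exists 0; intros _; ring.
      * exists (d + 1); intros Hm.
        apply (lt_succ (RCA0_basic HM)) in Hm; destruct Hm as [Hm | Hm]; [|contradiction].
        rewrite (Hd Hm) at 1; ring.
    + exists d; auto.
  - intros [d ->]; revert d; induct.
    + definable.
    + apply (lt_succ (RCA0_basic HM)); right; ring.
    + intros d Hd; apply (lt_succ (RCA0_basic HM)); left.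
      replace (m + (d + 1)) with (m + d + 1) by ring; exact Hd.
Qed.

Lemma le_iff m n : m <= n <-> exists d, n = m + d.
Proof.
  split.
  - intros [H | ->].
    + apply lt_iff in H; destruct H as [d ->]; exists (d + 1); ring.
    + exists 0; ring.
  - intros [d ->]; destruct (zero_or_succ d) as [-> | [k ->]].
    + right; ring.
    + left; apply lt_iff; exists k; ring.
Qed.

Lemma lt_irrefl m : ~ m < m.
Proof.
  intros H; apply lt_iff in H; destruct H as [d Hd].
  apply (succ_neq0 (RCA0_basic HM) (n := d)).
  apply (@add_cancel_l _ _ m); rewrite Hd at 2; ring.
Qed.

Lemma lt_trans m n k : m < n -> n < k -> m < k.
Proof.
  rewrite !lt_iff; intros [d ->] [d' ->]; exists (d + d' + 1); ring.
Qed.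

Lemma le_lt_trans m n k : m <= n -> n < k -> m < k.
Proof. intros [H | ->]; auto; now apply lt_trans. Qed.

Lemma lt_le_trans m n k : m < n -> n <= k -> m < k.
Proof. intros H [H' | <-]; auto; revert H H'; apply lt_trans. Qed.

Lemma le_trans m n k : m <= n -> n <= k -> m <= k.
Proof. intros H [H' | <-]; auto; left; revert H H'; apply le_lt_trans. Qed.

Lemma lt_succ_le m n : m < n + 1 <-> m <= n.
Proof. apply (lt_succ (RCA0_basic HM)). Qed.

Lemma le_succ_lt m n : m + 1 <= n <-> m < n.
Proof.
  rewrite le_iff, lt_iff; split; intros [d ->]; exists d; ring.
Qed.

Lemma le_0 n : 0 <= n.
Proof. apply le_iff; exists n; ring. Qed.

Lemma lt_0_absurd n : ~ n < 0.
Proof. apply (lt_0 (RCA0_basic HM)). Qed.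

Lemma lt_or_le m n : m < n \/ n <= m.
Proof.
  revert m; induct.
  - definable.
  - destruct (le_0 n) as [H | <-]; auto.
  - intros m [H | H].
    + apply le_succ_lt in H; destruct H; auto.
    + right; left; now apply lt_succ_le.
Qed.

Lemma not_lt m n : ~ m < n <-> n <= m.
Proof.
  split.
  - destruct (lt_or_le m n); tauto.
  - intros H H'; exact (lt_irrefl (le_lt_trans H H')).
Qed.

Lemma not_le m n : ~ m <= n <-> n < m.
Proof.
  split.
  - destruct (lt_or_le n m); tauto.
  - intros H H'; exact (lt_irrefl (le_lt_trans H' H)).
Qed.

Lemma le_antisym m n : m <= n -> n <= m -> m = n.
Proof.
  intros [H | H] H'; auto. exfalso; revert H'; now apply not_le.
Qed.

Lemma lt_self m : m < m + 1.
Proof. apply lt_succ_le; auto. Qed.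

End Arithmetic.

Ltac new_fact P :=
  lazymatch goal with
  | _ : P |- _ => fail
  | _ => idtac
  end.

Ltac ord_norm :=
  repeat match goal with
  | H : ~ lt _ _ |- _ => apply not_lt in H
  | H : ~ (lt _ _ \/ _ = _) |- _ => apply not_le in H
  | H : lt ?a (add ?b one) |- _ =>
      (* A fact [a < a + 1] is kept, since it would only become the trivial [a <= a]. *)
      tryif constr_eq a b then fail else apply lt_succ_le in H
  | H : lt (add _ one) _ \/ _ = _ |- _ => apply le_succ_lt in H
  | H : lt ?x zero |- _ => exfalso; exact (lt_0_absurd H)
  | H : lt ?x ?x |- _ => exfalso; exact (lt_irrefl H)
  end.

Ltac ord_close :=
  ord_norm;
  repeat (match goal with
  | H1 : lt ?a ?b, H2 : lt ?b ?c |- _ =>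
      new_fact (lt a c); pose proof (lt_trans H1 H2)
  | H1 : lt ?a ?b, H2 : lt ?b ?c \/ ?b = ?c |- _ =>
      new_fact (lt a c); pose proof (lt_le_trans H1 H2)
  | H1 : lt ?a ?b \/ ?a = ?b, H2 : lt ?b ?c |- _ =>
      new_fact (lt a c); pose proof (le_lt_trans H1 H2)
  | H1 : lt ?a ?b \/ ?a = ?b, H2 : lt ?b ?c \/ ?b = ?c |- _ =>
      new_fact (lt a c \/ a = c); pose proof (le_trans H1 H2)
  end; ord_norm).

Ltac ord_goal :=
  lazymatch goal with
  | |- False => idtac
  | |- lt ?a ?b => apply NNPP; intro
  | |- lt ?a ?b \/ ?a = ?b => apply NNPP; intro
  | |- ~ _ => intro
  | |- _ = _ => apply le_antisym; apply NNPP; intro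
  | |- _ => exfalso
  end.

(** Refutation: the goal is negated and the order hypotheses are closed under transitivity until
    [x < x] or [x < 0] appears. *)
Ltac ord := subst; ord_goal; ord_close.

(** * Injectivity of pairing, and comprehension for relations *)

Section Pairs.
Context {M : L2structure} {HM : RCA0 M}.
Add Ring M_ring_pairs : (@semiring M HM).
Implicit Types a b c d m n x y z : M.

Lemma le_add_l m n : m <= m + n.
Proof. apply le_iff; exists n; ring. Qed.

Lemma le_add_r m n : n <= m + n.
Proof. apply le_iff; exists m; ring. Qed.

Lemma le_mul_compat m n k : m <= n -> m * k <= n * k.
Proof. rewrite !le_iff; intros [d ->]; exists (d * k); ring. Qed.

Lemma lt_mul_compat m n k : m < n -> m * (k + 1) < n * (k + 1).
Proof. rewrite !lt_iff; intros [d ->]; exists (d * (k + 1) + k); ring. Qed.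

Lemma mul_succ_le_inv m n k : m * (k + 1) <= n * (k + 1) -> m <= n.
Proof.
  intros H; apply not_lt; intros H'; apply (lt_mul_compat k) in H'; ord.
Qed.

(** As [m <= m + n], this puts the code [(m + n)^2 + m] below the next square, so that the sum
    [m + n] can be recovered from it. *)
Lemma lt_square a b : a < b -> a * a + a < b * b.
Proof.
  rewrite !lt_iff; intros [d ->].
  exists (a * d + a + d * a + d * d + d + d); ring.
Qed.

Lemma pair_inj m n m' n' : pair m n = pair m' n' -> m = m' /\ n = n'.
Proof.
  assert (Hlt : forall m n m' n', m + n < m' + n' -> pair m n < pair m' n').
  { clear m n m' n'; intros m n m' n' H; apply lt_square in H; unfold pair.
    apply le_lt_trans with ((m + n) * (m + n) + (m + n)).
    - apply le_iff; exists n; ring.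
    - apply (lt_le_trans H), le_add_l. }
  intros H.
  destruct (lt_or_le (m + n) (m' + n')) as [H1 | [H1 | H1]].
  - apply Hlt in H1; rewrite H in H1; now apply lt_irrefl in H1.
  - apply Hlt in H1; rewrite H in H1; now apply lt_irrefl in H1.
  - unfold pair in H; rewrite H1 in H; apply add_cancel_l in H; subst m'.
    split; auto. symmetry; exact (add_cancel_l H1).
Qed.

Lemma le_pair_l m n : m <= pair m n.
Proof. apply le_add_r. Qed.

Lemma le_pair_r m n : n <= pair m n.
Proof.
  unfold pair; destruct (zero_or_succ n) as [-> | [k ->]].
  - apply le_0.
  - apply le_iff; exists (m * m + m * k + m + k * m + m + k * k + k + m); ring.
Qed.

Lemma lt_pair_l m n : m < pair m n + 1.
Proof. apply lt_succ_le, le_pair_l. Qed.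

Lemma lt_pair_r m n : n < pair m n + 1.
Proof. apply lt_succ_le, le_pair_r. Qed.

Lemma upper_bound x y : exists z, x <= z /\ y <= z.
Proof. exists (x + y); split; [apply le_add_l | apply le_add_r]. Qed.

End Pairs.

Ltac pair_inv :=
  repeat match goal with
  | H : pair _ _ = pair _ _ |- _ =>
      let H1 := fresh in let H2 := fresh in
      apply pair_inj in H; destruct H as [H1 H2]
  end; subst.

Section Comprehension.
Context {M : L2structure} {HM : RCA0 M}.

(** The components of a pair are bounded by the pair, so decoding costs only bounded quantifiers.
    That [X] contains nothing but pairs is used where [X] has to be the graph of a function. *)
Lemma comprehension2 (P : M -> M -> Prop) :
  rep Sigma00 2 (fun e _ => P (e 1%nat) (e O)) ->
  exists X : nset M, (forall a b, X (pair a b) <-> P a b) /\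
    (forall n, X n -> exists a b, n = pair a b).
Proof.
  intros HP.
  destruct (@comprehension M HM (fun n => exists a, a < n + 1 /\ exists b, b < n + 1 /\
    (n = pair a b /\ P a b))) as [X HX].
  - definable. now apply rep_weaken; [apply Sigma00_class|].
  - exists X; split.
    + intros a b; rewrite HX; split.
      * intros [a' [_ [b' [_ [E H]]]]]; pair_inv; auto.
      * intros H; exists a; split; [apply lt_pair_l|].
        exists b; split; [apply lt_pair_r | auto].
    + intros n H; apply HX in H; destruct H as [a [_ [b [_ [E _]]]]]; eauto.
Qed.

Lemma comprehension3 (P : M -> M -> M -> Prop) :
  rep Sigma00 3 (fun e _ => P (e 2%nat) (e 1%nat) (e O)) ->
  exists X : nset M, (forall a b c, X (pair (pair a b) c) <-> P a b c) /\
    (forall n, X n -> exists a b c, n = pair (pair a b) c).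
Proof.
  intros HP.
  destruct (@comprehension M HM (fun n => exists a, a < n + 1 /\ exists b, b < n + 1 /\
    exists c, c < n + 1 /\ (n = pair (pair a b) c /\ P a b c))) as [X HX].
  - definable. now apply rep_weaken; [apply Sigma00_class|].
  - exists X; split.
    + intros a b c; rewrite HX; split.
      * intros [a' [_ [b' [_ [c' [_ [E H]]]]]]]; pair_inv; auto.
      * intros H; exists a; split.
        { apply lt_succ_le; eapply le_trans; [|apply le_pair_l]; apply le_pair_l. }
        exists b; split.
        { apply lt_succ_le; eapply le_trans; [|apply le_pair_l]; apply le_pair_r. }
        exists c; split; [apply lt_pair_r | auto].
    + intros n H; apply HX in H; destruct H as [a [_ [b [_ [c [_ [E _]]]]]]]; eauto.
Qed.


Lemma comprehension4 (P : M -> M -> M -> M -> Prop) :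
  rep Sigma00 4 (fun e _ => P (e 3%nat) (e 2%nat) (e 1%nat) (e O)) ->
  exists X : nset M, (forall a b c d, X (pair (pair (pair a b) c) d) <-> P a b c d) /\
    (forall n, X n -> exists a b c d, n = pair (pair (pair a b) c) d).
Proof.
  intros HP.
  destruct (@comprehension M HM (fun n => exists a, a < n + 1 /\ exists b, b < n + 1 /\
    exists c, c < n + 1 /\ exists d, d < n + 1 /\
      (n = pair (pair (pair a b) c) d /\ P a b c d))) as [X HX].
  - definable. now apply rep_weaken; [apply Sigma00_class|].
  - exists X; split.
    + intros a b c d; rewrite HX; split.
      * intros [a' [_ [b' [_ [c' [_ [d' [_ [E H]]]]]]]]]; pair_inv; auto.
      * intros H; exists a; split.
        { apply lt_succ_le; do 2 (eapply le_trans; [|apply le_pair_l]); apply le_pair_l. }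
        exists b; split.
        { apply lt_succ_le; do 2 (eapply le_trans; [|apply le_pair_l]); apply le_pair_r. }
        exists c; split.
        { apply lt_succ_le; eapply le_trans; [|apply le_pair_l]; apply le_pair_r. }
        exists d; split; [apply lt_pair_r | auto].
    + intros n H; apply HX in H; destruct H as [a [_ [b [_ [c [_ [d [_ [E _]]]]]]]]]; eauto 6.
Qed.

End Comprehension.

(** * Codes of finite sets *)

Section Coding.
Context {M : L2structure} {HM : RCA0 M}.
Add Ring M_ring_coding : (@semiring M HM).
Implicit Types a b c d i j k l m n p q u v w x y z : M.

(** A substitute for the factorial: [m + 1] is a multiple of 1, ..., [l]. The bound on the quotient
    keeps the induction formula Sigma^0_1. *)
Lemma common_multiple l :
  exists m, forall d, d < l -> exists q, q < m + 1 + 1 /\ m + 1 = (d + 1) * q.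
Proof.
  revert l; apply Sigma_induction.
  - definable.
  - exists 0; intros d Hd; now apply lt_0_absurd in Hd.
  - intros l [m Hm]; exists (m * l + m + l); intros d Hd.
    assert (E : m * l + m + l + 1 = (m + 1) * (l + 1)) by ring; rewrite E.
    apply lt_succ_le in Hd; destruct Hd as [Hd | ->].
    + destruct (Hm d Hd) as [q [Hq Hq2]]; exists (q * (l + 1)); split.
      * apply lt_succ_le, le_mul_compat; now apply lt_succ_le.
      * rewrite Hq2; ring.
    + exists (m + 1); split; [|ring].
      apply lt_succ_le; rewrite <- E; apply le_iff; exists (m * l + l); ring.
Qed.

Lemma division a b : exists q r, r < a + 1 /\ b = (a + 1) * q + r.
Proof.
  revert b; apply Sigma_induction.
  - definable.
  - exists 0, 0; split; [apply lt_succ_le, le_0 | ring].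
  - intros b [q [r [Hr ->]]].
    destruct (lt_or_le (r + 1) (a + 1)) as [H | H].
    + exists q, (r + 1); split; [auto | ring].
    + assert (r = a) by ord; subst r; exists (q + 1), 0; split; [apply lt_succ_le, le_0 | ring].
Qed.

(** Invertibility of [b] modulo [a], without subtraction. Below, some moduli are written [a + 1 + 1]
    to make them at least 2: modulo 1, every positive number is both invertible and divisible. *)
Definition unit_mod a b := exists x y, x * b = y * a + 1.

Lemma unit_mod_bounded a b : unit_mod (a + 1 + 1) b ->
  exists x, x < a + 1 + 1 /\ exists y, y < b + 1 /\ x * b = y * (a + 1 + 1) + 1.
Proof.
  intros [x [y H]]; destruct (division (a + 1) x) as [q [r [Hr ->]]].
  exists r; split; [auto|].
  (* Reducing [x] to its remainder [r] changes the quotient [y] to [y - q * b]; the first case shows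
     that this is not negative. *)
  destruct (lt_or_le y (q * b)) as [H1 | H1].
  - exfalso; apply lt_iff in H1; destruct H1 as [d Hd].
    assert (E : r * b + (d * (a + 1 + 1) + a + 1) + 1 = 0 + 1).
    { apply add_cancel_l with (k := y * (a + 1 + 1)).
      transitivity (r * b + (a + 1 + 1) * (y + d + 1)); [ring|]. rewrite <- Hd.
      transitivity (((a + 1 + 1) * q + r) * b); [ring|]. rewrite H; ring. }
    apply (succ_inj (RCA0_basic HM)) in E.
    apply (succ_neq0 (RCA0_basic HM) (n := r * b + d * (a + 1 + 1) + a)).
    rewrite <- E; ring.
  - apply le_iff in H1; destruct H1 as [y' ->].
    assert (E : r * b = y' * (a + 1 + 1) + 1).
    { apply add_cancel_l with (k := q * b * (a + 1 + 1)).
      transitivity (((a + 1 + 1) * q + r) * b); [ring|]. rewrite H; ring. }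
    exists y'; split; auto.
    apply lt_succ_le, (@mul_succ_le_inv _ _ _ _ (a + 1)).
    apply le_trans with (r * b).
    + rewrite E; apply le_add_l.
    + rewrite (mul_comm b); apply le_mul_compat; auto.
Qed.

Lemma unit_mod_mul a b c : unit_mod a b -> unit_mod a c -> unit_mod a (b * c).
Proof.
  intros [x [y H]] [x' [y' H']]; exists (x * x'), (y * a * y' + y + y').
  transitivity ((x * b) * (x' * c)); [ring|]. rewrite H, H'; ring.
Qed.

Lemma unit_mod_sym a b : unit_mod a (b + 1 + 1) -> unit_mod (b + 1 + 1) a.
Proof.
  intros [x [y H]]; destruct (zero_or_succ (y * a)) as [E | [z E]].
  - exfalso; rewrite E in H; destruct (zero_or_succ x) as [-> | [x' ->]].
    + apply (succ_neq0 (RCA0_basic HM) (n := 0)); rewrite <- H; ring.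
    + assert (E' : x' * (b + 1 + 1) + b + 1 + 1 = 0 + 1) by (rewrite <- H; ring).
      apply (succ_inj (RCA0_basic HM)) in E'.
      now apply (succ_neq0 (RCA0_basic HM)) in E'.
  (* Modulo [b + 1 + 1], the product [y * a] is -1 and its square is 1; squaring replaces the
     negative inverse [-y] of [a] by [y * a * y]. *)
  - exists (y * a * y), (x * z).
    transitivity ((y * a) * (y * a)); [ring|].
    transitivity ((x * (b + 1 + 1)) * z + 1); [rewrite H, E; ring | ring].
Qed.

Lemma unit_mod_not_dvd a b q : unit_mod (a + 1 + 1) b -> b <> (a + 1 + 1) * q.
Proof.
  intros H ->; destruct H as [x [y H]].
  assert (E : (x * q) * (a + 1 + 1) = y * (a + 1 + 1) + 1) by (rewrite <- H; ring).
  destruct (lt_or_le y (x * q)) as [H1 | H1].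
  - apply lt_iff in H1; destruct H1 as [d Hd]; rewrite Hd in E.
    assert (E' : d * (a + 1 + 1) + a + 1 + 1 = 0 + 1).
    { apply add_cancel_l with (k := y * (a + 1 + 1)).
      transitivity ((y + d + 1) * (a + 1 + 1)); [ring|]. rewrite E; ring. }
    apply (succ_inj (RCA0_basic HM)) in E'.
    now apply (succ_neq0 (RCA0_basic HM)) in E'.
  - apply (le_mul_compat (a + 1 + 1)) in H1; rewrite E in H1.
    apply (@lt_irrefl _ _ (y * (a + 1 + 1))); now apply le_succ_lt.
Qed.

(** The moduli of Goedel's beta function, pairwise coprime for [j < l] if [m + 1] is a multiple of
    1, ..., [l]. *)
Definition modulus m j := (j + 1) * (m + 1) + 1.

Lemma modulus_eq m j : modulus m j = (j * (m + 1) + m) + 1 + 1.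
Proof. unfold modulus; ring. Qed.

(* With [a = modulus m j], [u = j + 1] and [m + 1 = (d + 1) t], one has
   [u (m + 1) = -1] modulo [a]; so the inverse of [(d + 1) (m + 1)], hence of
   [modulus m (j + d + 1) = a + (d + 1) (m + 1)], is [t u^2]. *)
Lemma modulus_coprime_lt m j d t :
  m + 1 = (d + 1) * t -> unit_mod (modulus m j) (modulus m (j + d + 1)).
Proof.
  intros H; pose (w := j * (m + 1) + m).
  exists (t * (j + 1) * (j + 1)), (t * (j + 1) * (j + 1) + w).
  assert (E1 : modulus m j = w + 1 + 1) by (unfold w, modulus; ring).
  assert (E2 : modulus m (j + d + 1) = w + 1 + 1 + (d + 1) * (m + 1)) by (unfold w, modulus; ring).
  rewrite E1, E2.
  transitivity (t * (j + 1) * (j + 1) * (w + 1 + 1)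
    + (j + 1) * ((d + 1) * t) * ((j + 1) * (m + 1))); [ring|].
  rewrite <- H; replace ((j + 1) * (m + 1)) with (w + 1) by (unfold w; ring); ring.
Qed.

Lemma modulus_coprime l m i j :
  (forall d, d < l -> exists q, q < m + 1 + 1 /\ m + 1 = (d + 1) * q) ->
  i < l -> j < l -> i <> j -> unit_mod (modulus m i) (modulus m j).
Proof.
  intros Hm Hi Hj Hij.
  assert (K : forall i j, j < l -> i < j -> unit_mod (modulus m i) (modulus m j)).
  { clear i j Hi Hj Hij; intros i j Hj Hij.
    apply lt_iff in Hij; destruct Hij as [d ->].
    destruct (Hm d) as [q [_ Hq]].
    - pose proof (le_add_r i d); pose proof (lt_self (i + d)); ord.
    - exact (modulus_coprime_lt i Hq). }
  destruct (lt_or_le i j) as [H | [H | H]]; [auto | | congruence].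
  rewrite (modulus_eq m i); apply unit_mod_sym; rewrite <- modulus_eq; auto.
Qed.

(** The code [n] is the product of the moduli that belong to the elements of [A] below [l]; the
    remaining moduli are coprime to it, hence do not divide it. *)
Lemma finite_set_code (A : nset M) l :
  exists m n, forall j, j < l -> ((exists q, q < n + 1 /\ n = modulus m j * q) <-> A j).
Proof.
  destruct (common_multiple l) as [m Hm]; exists m.
  (* Invertibility modulo a modulus is stated with bounds on the witnesses, which
     keeps the induction hypothesis Sigma^0_1. *)
  assert (K : forall k, exists n, forall j, j < l ->
    (j < k /\ A j -> exists q, q < n + 1 /\ n = ((j + 1) * (m + 1) + 1) * q) /\
    (~ (j < k /\ A j) -> exists x, x < (j + 1) * (m + 1) + 1 /\ exists y, y < n + 1 /\
       x * n = y * ((j + 1) * (m + 1) + 1) + 1)).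
  { apply Sigma_induction.
    - definable.
    - exists 1; intros j Hj; split; intros H.
      + destruct H as [H _]; now apply lt_0_absurd in H.
      + exists 1; split.
        * apply lt_iff; exists (j * (m + 1) + m); ring.
        * exists 0; split; [apply lt_succ_le, le_0 | ring].
    - intros k [n Hn].
      destruct (classic (k < l /\ A k)) as [[Hk HA] | Hk].
      + exists (n * modulus m k); intros j Hj.
        destruct (Hn j Hj) as [H1 H2]; fold (modulus m j) in *.
        split; intros H.
        * assert (E : exists q, n * modulus m k = modulus m j * q).
          { destruct (classic (j = k)) as [-> | Hjk].
            - exists n; ring.
            - destruct H1 as [q [_ Hq]].
              + destruct H as [H HA']; apply lt_succ_le in H; destruct H; tauto.
              + exists (q * modulus m k); rewrite Hq at 1; ring. }
          destruct E as [q Hq]; exists q; split; auto.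
          rewrite Hq; apply lt_succ_le; unfold modulus.
          apply le_iff; exists ((j + 1) * (m + 1) * q); ring.
        * rewrite modulus_eq; apply unit_mod_bounded; rewrite <- modulus_eq.
          assert (Hjk : j <> k).
          { intros ->; apply H; split; auto; apply lt_self. }
          apply unit_mod_mul.
          -- destruct H2 as [x [_ [y [_ E]]]].
             ++ intros [H3 H4]; apply H; split; auto. pose proof (lt_self k); ord.
             ++ exists x, y; auto.
          -- apply (@modulus_coprime l); auto.
      + exists n; intros j Hj; destruct (Hn j Hj) as [H1 H2].
        assert (E : j < k + 1 /\ A j <-> j < k /\ A j).
        { rewrite lt_succ_le; split; intros [H3 H4]; [|tauto].
          destruct H3 as [H3 | ->]; tauto. }
        rewrite E; auto. }
  destruct (K l) as [n Hn]; exists n; intros j Hj; destruct (Hn j Hj) as [H1 H2]; split.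
  - intros [q [_ Hq]]; apply NNPP; intros HA; destruct H2 as [x [_ [y [_ E]]]]; [tauto|].
    rewrite modulus_eq in Hq; revert Hq; apply unit_mod_not_dvd.
    rewrite <- modulus_eq; exists x, y; auto.
  - intros HA; apply H1; auto.
Qed.

(* [B (pair c j)] says that [j] is in the finite set coded by [c]. *)
Lemma finite_set_coding : exists B : nset M,
  forall (A : nset M) l, exists c, forall j, j < l -> (B (pair c j) <-> A j).
Proof.
  destruct (@comprehension3 M HM (fun m n j => exists q, q < n + 1 /\
    n = ((j + 1) * (m + 1) + 1) * q)) as [B [HB _]].
  - definable.
  - exists B; intros A l; destruct (finite_set_code A l) as [m [n H]].
    exists (pair m n); intros j Hj; rewrite HB; apply H; auto.
Qed.

End Coding.

(** * Iteration of functions, and powers of 2 *)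

Section Iteration.
Context {M : L2structure} {HM : RCA0 M}.
Add Ring M_ring_iter : (@semiring M HM).
Implicit Types a b c d i j k l m n p q u v w x y z : M.

(** Finite computations are coded as finite sets of pairs (stage, value). They exist by Sigma^0_1
    induction, and any two agree where both are defined, which makes the graph of the iteration
    Delta^0_1. *)
Lemma iteration (F : nset M) (a : M) :
  (forall x, exists y, F (pair x y)) ->
  (forall x y z, F (pair x y) -> F (pair x z) -> y = z) ->
  exists g : nset M, is_function (all_num (M := M)) (all_num (M := M)) g /\ g (pair 0 a) /\
    forall i x y, g (pair i x) -> F (pair x y) -> g (pair (i + 1) y).
Proof.
  intros Ftot Ffun; destruct (finite_set_coding (M := M)) as [B HB].
  destruct (@comprehension2 M HM (fun c l => forall i, i < l -> forall w, w < l ->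
    pair i w < l -> B (pair c (pair i w)) -> (i = 0 /\ w = a) \/
      exists i', i' < l /\ exists w', w' < l /\ (i = i' + 1 /\ F (pair w' w) /\
        pair i' w' < l /\ B (pair c (pair i' w'))))) as [S [HS _]]; [definable|].
  (* [S (pair c l)]: the part below [l] of the set coded by [c] is a set of pairs
     [pair i w] in which [w] is the [i]-th iterate, with all its predecessors. *)
  pose (E := fun k v c l => S (pair c l) /\ pair k v < l /\ B (pair c (pair k v))).
  assert (Efun : forall c l c' l' k v v', E k v c l -> E k v' c' l' -> v = v').
  { intros c l c' l' k v v' [H1 [H2 H3]] [H1' [H2' H3']].
    rewrite HS in H1, H1'.
    assert (K : forall i, forall w, w < l -> forall w', w' < l' -> pair i w < l ->
      pair i w' < l' -> B (pair c (pair i w)) -> B (pair c' (pair i w')) -> w = w').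
    { induct; [definable | |].
      - intros w Hw w' Hw' Hp Hp' Hb Hb'.
        assert (H0 : (0 : M) < l) by (pose proof (le_0 w); ord).
        assert (H0' : (0 : M) < l') by (pose proof (le_0 w'); ord).
        destruct (H1 0 H0 w Hw Hp Hb) as [[_ ->] | [i [_ [? [_ [Ei _]]]]]];
          [|symmetry in Ei; now apply (succ_neq0 (RCA0_basic HM)) in Ei].
        destruct (H1' 0 H0' w' Hw' Hp' Hb') as [[_ ->] | [i [_ [? [_ [Ei _]]]]]];
          [auto|symmetry in Ei; now apply (succ_neq0 (RCA0_basic HM)) in Ei].
      - intros i IH w Hw w' Hw' Hp Hp' Hb Hb'.
        assert (Hi : i + 1 < l) by (pose proof (le_pair_l (i + 1) w); exact (le_lt_trans H Hp)).
        assert (Hi' : i + 1 < l') by (pose proof (le_pair_l (i + 1) w'); exact (le_lt_trans H Hp')).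
        destruct (H1 _ Hi w Hw Hp Hb) as [[Ei _] | [i1 [_ [w1 [Hw1 [Ei [HF [Hp1 Hb1]]]]]]]];
          [now apply (succ_neq0 (RCA0_basic HM)) in Ei|].
        destruct (H1' _ Hi' w' Hw' Hp' Hb') as [[Ei' _] | [i2 [_ [w2 [Hw2 [Ei' [HF' [Hp2 Hb2]]]]]]]];
          [now apply (succ_neq0 (RCA0_basic HM)) in Ei'|].
        apply (succ_inj (RCA0_basic HM)) in Ei, Ei'; subst i1 i2.
        assert (w1 = w2) by (apply IH; auto); subst w2.
        exact (Ffun _ _ _ HF HF'). }
    apply (K k); auto.
    - exact (le_lt_trans (le_pair_r k v) H2).
    - exact (le_lt_trans (le_pair_r k v') H2'). }
  assert (Einit : exists c l, E 0 a c l).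
  { destruct (@comprehension M HM (fun n => n = pair 0 a)) as [A HA]; [definable|].
    destruct (HB A (pair 0 a + 1)) as [c Hc]; exists c, (pair 0 a + 1).
    split; [|split; [apply lt_self|]].
    - apply HS; intros i _ w _ Hp Hb; left.
      apply Hc, HA in Hb; auto; pair_inv; auto.
    - apply Hc; [apply lt_self | now apply HA]. }
  assert (Estep : forall k v w c l, E k v c l -> F (pair v w) -> exists c' l', E (k + 1) w c' l').
  { intros k v w c l [H1 [H2 H3]] HF.
    destruct (@comprehension M HM (fun n => (n < l /\ B (pair c n)) \/ n = pair (k + 1) w))
      as [A HA]; [definable|].
    destruct (upper_bound l (pair (k + 1) w + 1)) as [l' [Hl Hl']].
    destruct (HB A l') as [c' Hc]; exists c', l'.
    assert (Hk : forall p, p < l -> B (pair c p) -> p < l' /\ B (pair c' p)).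
    { intros p Hp Hb; assert (p < l') by ord; split; auto; apply Hc, HA; auto. }
    split; [|split].
    - apply HS; rewrite HS in H1; intros i _ x _ Hp Hb.
      apply Hc, HA in Hb; auto; destruct Hb as [[Hp' Hb] | Ep].
      + destruct (H1 i) with (w := x) as [Hz | [i' [Hi' [x' [Hx' [Ei [HF' [Hp1 Hb1]]]]]]]]; auto.
        * exact (le_lt_trans (le_pair_l i x) Hp').
        * exact (le_lt_trans (le_pair_r i x) Hp').
        * right; exists i'; split; [ord|]; exists x'; split; [ord|].
          split; auto; split; auto.
      + pair_inv; right. exists k; destruct (Hk _ H2 H3) as [H4 H5].
        split; [exact (le_lt_trans (le_pair_l k v) H4)|].
        exists v; split; [exact (le_lt_trans (le_pair_r k v) H4)|]; auto.
    - exact (lt_le_trans (lt_self _) Hl').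
    - apply Hc; [exact (lt_le_trans (lt_self _) Hl') | apply HA; auto]. }
  assert (Etot : forall k, exists v c l, E k v c l).
  { intros k.
    (* The three witnesses are bounded by a single number, as [Sigma_induction] allows one unbounded
       quantifier. *)
    destruct (@Sigma_induction M HM (fun k m => exists v, v < m + 1 /\ exists c, c < m + 1 /\
      exists l, l < m + 1 /\ (S (pair c l) /\ pair k v < l /\ B (pair c (pair k v)))))
      with (n := k) as [m [v [_ [c [_ [l [_ H]]]]]]].
    - definable.
    - destruct Einit as [c [l H]]; exists (pair (pair a c) l).
      exists a; split; [apply lt_succ_le; eapply le_trans; [|apply le_pair_l]; apply le_pair_l|].
      exists c; split; [apply lt_succ_le; eapply le_trans; [|apply le_pair_l]; apply le_pair_r|].
      exists l; split; [apply lt_pair_r | exact H].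
    - intros i [m [v [_ [c [_ [l [_ H]]]]]]].
      destruct (Ftot v) as [w Hw]; destruct (Estep _ _ _ _ _ H Hw) as [c' [l' H']].
      exists (pair (pair w c') l').
      exists w; split; [apply lt_succ_le; eapply le_trans; [|apply le_pair_l]; apply le_pair_l|].
      exists c'; split; [apply lt_succ_le; eapply le_trans; [|apply le_pair_l]; apply le_pair_r|].
      exists l'; split; [apply lt_pair_r | exact H'].
    - exists v, c, l; exact H. }
  (* The Sigma form says that some computation yields [v] at stage [k], the Pi form that every
     computation reaching stage [k] does. *)
  destruct (@Delta_comprehension M HM
    (fun n m => exists k, k < n + 1 /\ exists v, v < n + 1 /\ (n = pair k v /\
       exists c, c < m + 1 /\ exists l, l < m + 1 /\
         (S (pair c l) /\ pair k v < l /\ B (pair c (pair k v)))))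
    (fun n m => exists k, k < n + 1 /\ exists v, v < n + 1 /\ (n = pair k v /\
       forall v', v' < m + 1 -> forall c, c < m + 1 -> forall l, l < m + 1 ->
         (S (pair c l) /\ pair k v' < l /\ B (pair c (pair k v'))) -> v' = v)))
    as [g Hg]; [definable | definable | |].
  { intros n; split.
    - intros [m [k [Hk [v [Hv [-> [c [_ [l [_ H]]]]]]]]]] m'.
      exists k; split; auto; exists v; split; auto; split; auto.
      intros v' _ c' _ l' _ H'; exact (Efun _ _ _ _ _ _ _ H' H).
    - intros H; destruct (H 0) as [k [Hk [v [Hv [-> _]]]]].
      destruct (Etot k) as [v' [c [l He]]].
      destruct (H (pair (pair v' c) l)) as [k1 [_ [v1 [_ [Ep H']]]]]; pair_inv.
      assert (v' = v1).
      { apply H' with (c := c) (l := l); auto.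
        - apply lt_succ_le; eapply le_trans; [|apply le_pair_l]; apply le_pair_l.
        - apply lt_succ_le; eapply le_trans; [|apply le_pair_l]; apply le_pair_r.
        - apply lt_pair_r. }
      subst v'; exists (pair c l), k1; split; auto; exists v1; split; auto; split; auto.
      exists c; split; [apply lt_pair_l|]; exists l; split; [apply lt_pair_r | auto]. }
  assert (Hg' : forall k v, g (pair k v) <-> exists c l, E k v c l).
  { intros k v; rewrite Hg; split.
    - intros [m [k' [_ [v' [_ [Ep [c [_ [l [_ H]]]]]]]]]]; pair_inv; exists c, l; exact H.
    - intros [c [l H]]; exists (pair c l), k; split; [apply lt_pair_l|].
      exists v; split; [apply lt_pair_r|]; split; auto.
      exists c; split; [apply lt_pair_l|]; exists l; split; [apply lt_pair_r | exact H]. }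
  exists g; split; [split; [split|]|split].
  - intros p Hp; apply Hg in Hp.
    destruct Hp as [_ [k [_ [v [_ [-> _]]]]]]; exists k, v; repeat split.
  - intros k v v'; rewrite !Hg'; intros [c [l H]] [c' [l' H']]; exact (Efun _ _ _ _ _ _ _ H H').
  - intros k _; destruct (Etot k) as [v H]; exists v; now apply Hg'.
  - apply Hg', Einit.
  - intros i x y; rewrite !Hg'; intros [c [l H]] HF; exact (Estep _ _ _ _ _ H HF).
Qed.

(** The bound [k <= c] amounts to [k < 2^k], which makes the negative powers of 2 arbitrarily
    small. *)
Lemma pow2_exists (k : M) : exists c, is_pow2 k (c + 1) /\ k <= c.
Proof.
  destruct (@comprehension2 M HM (fun x y => y = x + x)) as [F [HF _]]; [definable|].
  destruct (@iteration F 1) as [g [Hg [Hg0 HgS]]].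
  - intros x; exists (x + x); now apply HF.
  - intros x y z; rewrite !HF; congruence.
  - assert (K : forall k, exists v, g (pair k v) /\ k < v).
    { apply Sigma_induction; [definable | |].
      - exists 1; split; auto; apply lt_iff; exists 0; ring.
      - intros i [v [Hv Hi]]; exists (v + v); split.
        + apply (HgS i v); auto; now apply HF.
        + apply lt_iff in Hi; destruct Hi as [d ->]; apply lt_iff; exists (d + i + d); ring. }
    destruct (K k) as [v [Hv Hk]].
    destruct (zero_or_succ v) as [-> | [c ->]]; [now apply lt_0_absurd in Hk|].
    exists c; split; [|now apply lt_succ_le].
    exists g; split; [auto|]; split; [auto|]; split; [|auto].
    intros j v Hj; apply (HgS j v); auto; now apply HF.
Qed.

End Iteration.

(** * Spaces from orders and from closeness relations *)

Section Alexandrov.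
Context {M : L2structure} {HM : RCA0 M}.

(* The basic open sets are the cones [{x : x = j \/ R j x}]; the isolated points
   of a subspace are then its [R]-maximal points. *)
Lemma noetherian_index_set (X R : nset M) :
  scattered_index_set_exists M ->
  (forall i x y z, R (pair (pair x y) i) -> R (pair (pair y z) i) -> R (pair (pair x z) i)) ->
  (forall i x, ~ R (pair (pair x x) i)) ->
  exists Z : nset M, forall i, Z i <->
    forall Y : nset M, (forall x, Y x -> X (pair x i)) -> (exists x, Y x) ->
      exists x, Y x /\ forall y, Y y -> ~ R (pair (pair x y) i).
Proof.
  intros HS Rtrans Rirr.
  destruct (@comprehension3 M HM (fun x j i => X (pair x i) /\ (x = j \/ R (pair (pair j x) i))))
    as [U [HU _]]; [definable|].
  (* The cone of [x] is the least open set around [x], so [k (x, a, b) = x] is a correct choice. *)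
  destruct (@comprehension2 M HM (fun n i => exists x, x < n + 1 /\ exists a, a < n + 1 /\
    exists b, b < n + 1 /\ (n = pair (pair (pair x a) b) x /\ X (pair x i)))) as [k [Hk _]];
    [definable|].
  assert (Hk' : forall x a b l i, k (pair (pair (pair (pair x a) b) l) i) <-> x = l /\ X (pair x i)).
  { intros x a b l i; rewrite Hk; split.
    - intros [x' [_ [a' [_ [b' [_ [E H]]]]]]]; pair_inv; auto.
    - intros [<- H]; exists x; split; [apply lt_pair_r|].
      exists a; split.
      { apply lt_succ_le; do 2 (eapply le_trans; [|apply le_pair_l]); apply le_pair_r. }
      exists b; split; [|auto].
      apply lt_succ_le; eapply le_trans; [|apply le_pair_l]; apply le_pair_r. }
  destruct (HS X U k) as [Z HZ].
  - intros i; split; unfold section.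
    + intros j x H; apply HU in H; tauto.
    + intros x H; exists x; apply HU; auto.
    + split.
      * intros p H; apply Hk in H.
        destruct H as [x [_ [a [_ [b [_ [-> H]]]]]]].
        exists (pair (pair x a) b), x; repeat split.
        exists (pair x a), b; repeat split. exists x, a; repeat split; auto.
      * intros q l l' H H'; apply Hk in H.
        destruct H as [x [_ [a [_ [b [_ [E H]]]]]]]; pair_inv.
        apply Hk' in H'; tauto.
    + intros x a b; rewrite !HU; intros [Hx Ha] [_ Hb].
      exists x; split; [now apply Hk'|]; split; [now apply HU; auto|].
      intros y; rewrite !HU; intros [Hy Hxy].
      destruct Hxy as [-> | Hxy]; [auto|].
      split; split; auto; right.
      * destruct Ha as [-> | Ha]; [auto|]. exact (Rtrans _ _ _ _ Ha Hxy).
      * destruct Hb as [-> | Hb]; [auto|]. exact (Rtrans _ _ _ _ Hb Hxy).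
  - exists Z; intros i; rewrite HZ; unfold scattered, isolated_in, section.
    split; intros H Y HY1 HY2; destruct (H Y HY1 HY2) as [x [Hx Hx']]; exists x; split; auto.
    + intros y Hy Hxy; destruct Hx' as [j [Hj Hj']].
      apply HU in Hj; destruct Hj as [Hxi Hj].
      assert (y = x).
      { apply Hj'; auto; apply HU; split; auto; right.
        destruct Hj as [<- | Hj]; auto. exact (Rtrans _ _ _ _ Hj Hxy). }
      subst y; exact (Rirr _ _ Hxy).
    + exists x; split; [apply HU; auto|].
      intros y Hy Yy; apply HU in Hy; destruct Hy as [_ [Hy | Hy]]; auto.
      now apply Hx' in Hy.
Qed.

End Alexandrov.

(** * Rational numbers *)

Section Rationals.
Context {M : L2structure} {HM : RCA0 M}.
Add Ring M_ring_rat : (@semiring M HM).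

Lemma rat_code_inj (p q : rat M) : rat_code p = rat_code q -> p = q.
Proof.
  destruct p, q; unfold rat_code; simpl; intros H; pair_inv; auto.
Qed.

Lemma rat_dist_le_refl (p e : rat M) : rneg e = 0 -> rat_dist_le p p e.
Proof.
  destruct p as [a b c], e as [a' b' c']; simpl; intros ->.
  unfold rat_dist_le, rat_le; simpl; split; apply le_iff;
    exists (a' * (c * c + c + c + 1)); ring.
Qed.

Lemma rat_le_add_r (p q e : rat M) : rneg e = 0 -> rat_le p q -> rat_le p (rat_add q e).
Proof.
  destruct p as [a b c], q as [a' b' c'], e as [u v w]; simpl; intros ->.
  unfold rat_le; simpl; rewrite !le_iff; intros [d H].
  exists (d * (w + 1) + u * (c' + 1) * (c + 1)).
  transitivity ((a' * (c + 1) + b * (c' + 1)) * (w + 1) + u * (c' + 1) * (c + 1)); [ring|].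
  rewrite H; ring.
Qed.

Lemma rat_le_add_l (p q e : rat M) : rneg e = 0 -> rat_le p q -> rat_le p (rat_add e q).
Proof.
  destruct p as [a b c], q as [a' b' c'], e as [u v w]; simpl; intros ->.
  unfold rat_le; simpl; rewrite !le_iff; intros [d H].
  exists (d * (w + 1) + u * (c' + 1) * (c + 1)).
  transitivity ((a' * (c + 1) + b * (c' + 1)) * (w + 1) + u * (c' + 1) * (c + 1)); [ring|].
  rewrite H; ring.
Qed.

Lemma rat_le_refl (p : rat M) : rat_le p p.
Proof. right; reflexivity. Qed.

(** Removes the slack [2^(-k+1)] in the comparison of reals that are given by constant sequences. *)
Lemma rat_le_archimedean (p q : rat M) :
  (forall k e, is_inv_pow2 k e -> rat_le p (rat_add q (rat_add e e))) -> rat_le p q.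
Proof.
  intros H; apply NNPP; intros Hpq; destruct p as [a b c], q as [a' b' c'].
  (* If [q < p], the difference is at least [1 / ((c + 1) * (c' + 1))]; a power of 2 above twice
     this denominator makes the slack [2 / (r + 1)] smaller. *)
  destruct (pow2_exists ((c + 1) * (c' + 1) + (c + 1) * (c' + 1))) as [r [Hr Hr']].
  specialize (H _ (Rat 1 0 r) (ex_intro _ r (conj Hr eq_refl))); unfold rat_le in *; simpl in *.
  apply not_le, lt_iff in Hpq; destruct Hpq as [d Hd].
  apply le_iff in H; destruct H as [u Hu].
  assert (E : ((c + 1) * (c' + 1) + (c + 1) * (c' + 1)) * (r + 1) =
    (r + 1) * (r + 1) + (d * (r + 1) * (r + 1) + u)).
  { apply add_cancel_l with (k := (r + 1) * (r + 1) * (a' * (c + 1) + b * (c' + 1))).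
    transitivity ((a * (c' + 1) + b' * (c + 1)) * ((r + 1) * (r + 1)) + u).
    - transitivity ((a' * (r * r + r + r + 1) + (1 * (r + 1) + 1 * (r + 1)) * (c' + 1)) * (c + 1) +
         b * (c' * (r * r + r + r) + c' + (r * r + r + r) + 1)); [ring|].
      rewrite Hu; ring.
    - rewrite Hd; ring. }
  assert (L : (r + 1) * (r + 1) <= ((c + 1) * (c' + 1) + (c + 1) * (c' + 1)) * (r + 1)).
  { rewrite E; apply le_add_l. }
  apply mul_succ_le_inv in L; ord.
Qed.

End Rationals.

(** * Ultrametric spaces from closeness relations *)

Section Ultrametric.
Context {M : L2structure} {HM : RCA0 M}.
Add Ring M_ring_ultra : (@semiring M HM).
Implicit Types b i k m n u v w x y z : M.

(* [close x y b] is read as "[x = y] or d(x, y) <= 1 / (b + 1)". *)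
Definition close_complete (X : M -> Prop) (close : M -> M -> M -> Prop) : Prop :=
  forall a : nset M, is_function (all_num (M := M)) X a ->
    (forall b, exists n0, forall m n x y, n0 <= m -> n0 <= n ->
      a (pair m x) -> a (pair n y) -> x = y \/ close x y b) ->
    exists x, X x /\ forall b, exists n0, forall n y, n0 <= n -> a (pair n y) ->
      y = x \/ close y x b.

(** Reflexivity is not demanded, and [close_bound] excludes it at large levels: a string is close to
    itself only up to its length. Equality is therefore a separate case throughout. *)
Record closeness (X : M -> Prop) (close : M -> M -> M -> Prop) : Prop := {
  close_0 : forall x y, X x -> X y -> close x y 0;
  close_le : forall x y u v, u <= v -> close x y v -> close x y u;
  close_bound : forall x y, X x -> X y -> exists b, ~ close x y b;
  close_sym : forall x y b, close x y b -> close y x b;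
  close_trans : forall x y z b, close x y b -> close y z b -> close x z b
}.

(** For distinct points, the last level [v] of closeness gives the distance [1 / (v + 1)]. *)
Definition close_value (close : M -> M -> M -> Prop) x y (q : rat M) : Prop :=
  (x = y /\ q = rat0 M) \/
  (x <> y /\ exists v, q = Rat 1 0 v /\ close x y v /\ ~ close x y (v + 1)).

Section OneSpace.
Variables (X d : M -> Prop) (close : M -> M -> M -> Prop).
Hypothesis (Hclose : closeness X close).
Hypothesis (close_set : forall x y, exists S : nset M, forall b, S b <-> close x y b).
Hypothesis (Hd : forall n, d n <-> exists x y k q,
  n = pair (pair (pair x y) k) (rat_code q) /\ X x /\ X y /\ close_value close x y q).

Lemma close_value_exists x y : X x -> X y -> exists q, close_value close x y q.
Proof.
  intros Hx Hy; destruct (classic (x = y)) as [Hxy | Hxy].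
  - exists (rat0 M); left; auto.
  - apply NNPP; intros H.
    (* Without a last level, induction would make [x] and [y] close at all levels, against
       [close_bound]. For this induction the levels have to form a set. *)
    destruct (close_bound Hclose Hx Hy) as [b Hb]; apply Hb; clear Hb.
    destruct (close_set x y) as [S HS]; apply HS; revert b.
    induct; [definable | apply HS, (close_0 Hclose); auto|].
    intros v Hv; apply NNPP; intros Hv'; apply H; exists (Rat 1 0 v); right; split; auto.
    exists v; rewrite <- !HS; auto.
Qed.

Lemma close_value_le x y v b :
  close x y v -> ~ close x y (v + 1) -> (close x y b <-> b <= v).
Proof.
  intros H1 H2; split; intros H.
  - apply not_lt; intros H3; apply H2; revert H; apply (close_le Hclose).
    now apply le_succ_lt.
  - exact (close_le Hclose H H1).
Qed.

Lemma close_value_unique x y q q' :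
  close_value close x y q -> close_value close x y q' -> q = q'.
Proof.
  intros [[Hxy ->] | [Hxy [v [-> [H1 H2]]]]] [[Hxy' ->] | [Hxy' [v' [-> [H1' H2']]]]];
    try contradiction; auto.
  f_equal; apply le_antisym; [now apply (close_value_le _ H1' H2') | now apply (close_value_le _ H1 H2)].
Qed.

Lemma close_value_sym x y q : close_value close x y q -> close_value close y x q.
Proof.
  intros [[-> ->] | [Hxy [v [-> [H1 H2]]]]]; [left; auto | right; split; auto].
  exists v; split; auto; split; [now apply (close_sym Hclose)|].
  intros H; now apply H2, (close_sym Hclose).
Qed.

Lemma close_value_ge0 x y q : close_value close x y q -> rneg q = 0.
Proof. intros [[_ ->] | [_ [v [-> _]]]]; reflexivity. Qed.

(** The right side does not depend on [k]: every distance is a constant sequence of rationals, so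
    the laws for reals reduce to laws for rationals. *)
Lemma dist_iff x y k q : dist d x y k q <-> X x /\ X y /\ close_value close x y q.
Proof.
  unfold dist; rewrite Hd; split.
  - intros [x' [y' [k' [q' [E H]]]]]; apply pair_inj in E; destruct E as [E1 E2].
    apply rat_code_inj in E2; pair_inv; auto.
  - intros H; exists x, y, k, q; auto.
Qed.

Lemma inv_pow2_ge0 k (e : rat M) : is_inv_pow2 k e -> rneg (rat_add e e) = 0.
Proof. intros [c [_ ->]]; simpl; ring. Qed.

Lemma rat_le_0 (p q : rat M) : rpos p = 0 -> rneg q = 0 -> rat_le p q.
Proof.
  destruct p as [a b c], q as [a' b' c']; simpl; intros -> ->.
  unfold rat_le; simpl; apply le_iff; exists (a' * (c + 1) + b * (c' + 1)); ring.
Qed.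

(** By transitivity at level [t + 1], one of [p] and [q] is already at least [r], and the other is
    nonnegative. *)
Lemma close_value_triangle x y z p q r : X x -> X y -> X z ->
  close_value close x z r -> close_value close x y p -> close_value close y z q ->
  rat_le r (rat_add p q).
Proof.
  intros Hx Hy Hz Hr Hp Hq.
  pose proof (close_value_ge0 Hp) as Hp0; pose proof (close_value_ge0 Hq) as Hq0.
  destruct Hr as [[Hxz ->] | [Hxz [t [-> [Ht1 Ht2]]]]].
  { apply rat_le_0; simpl; rewrite ?Hp0, ?Hq0; ring. }
  assert (K : forall v, t < v -> close x z v -> False).
  { intros v Hv H; apply Ht2; revert H; apply (close_le Hclose); now apply le_succ_lt. }
  destruct Hp as [[Hxy ->] | [Hxy [u [-> [Hu1 Hu2]]]]].
  { apply rat_le_add_l; auto; subst y.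
    rewrite (@close_value_unique x z (Rat 1 0 t) q); [apply rat_le_refl | |auto].
    right; split; auto; exists t; auto. }
  destruct Hq as [[Hyz ->] | [Hyz [v [-> [Hv1 Hv2]]]]].
  { apply rat_le_add_r; auto; subst z.
    rewrite (@close_value_unique x y (Rat 1 0 t) (Rat 1 0 u)); [apply rat_le_refl | |];
      right; split; auto; eexists; split; eauto. }
  assert (L : forall w, w <= t -> rat_le (Rat 1 0 t) (Rat 1 0 w)).
  { intros w Hw; unfold rat_le; simpl; apply le_iff in Hw; destruct Hw as [s ->].
    apply le_iff; exists s; ring. }
  destruct (lt_or_le t u) as [Hu | Hu]; [|apply rat_le_add_r; auto].
  destruct (lt_or_le t v) as [Hv | Hv]; [|apply rat_le_add_l; auto].
  exfalso; apply (K (t + 1) (lt_self t)), (close_trans Hclose) with (y := y).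
  - apply (close_le Hclose) with (v := u); auto; now apply le_succ_lt.
  - apply (close_le Hclose) with (v := v); auto; now apply le_succ_lt.
Qed.

Lemma closeness_metric : is_metric_space X d.
Proof.
  split.
  - split; [split|].
    + intros n Hn; apply Hd in Hn; destruct Hn as [x [y [k [q [-> [Hx [Hy _]]]]]]].
      exists (pair (pair x y) k), (rat_code q); repeat split; [|now exists q].
      exists (pair x y), k; repeat split; exists x, y; auto.
    + intros n r r' Hr Hr'; apply Hd in Hr, Hr'.
      destruct Hr as [x [y [k [q [E [_ [_ H]]]]]]], Hr' as [x' [y' [k' [q' [E' [_ [_ H']]]]]]].
      apply pair_inj in E, E'; destruct E as [-> ->], E' as [E' ->]; pair_inv.
      f_equal; exact (close_value_unique H H').
    + intros n [p [k [-> [[x [y [-> [Hx Hy]]]] _]]]].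
      destruct (close_value_exists Hx Hy) as [q Hq]; exists (rat_code q).
      apply Hd; exists x, y, k, q; auto.
  - intros x y Hx Hy k i p q e; rewrite !dist_iff; intros [_ [_ Hp]] [_ [_ Hq]] [c [_ ->]].
    rewrite (close_value_unique Hp Hq); now apply rat_dist_le_refl.
  - intros x y Hx Hy k p q e ->; rewrite dist_iff; intros [_ [_ Hq]] He.
    apply rat_le_add_r; [exact (inv_pow2_ge0 He)|].
    apply rat_le_0; [reflexivity | exact (close_value_ge0 Hq)].
  - intros x y Hx Hy; split.
    + intros H; destruct (close_value_exists Hx Hy) as [q Hq].
      assert (L : rat_le q (rat0 M)).
      { apply rat_le_archimedean; intros k e He.
        destruct (H k q (rat0 M) e) as [H1 _]; auto; [now apply dist_iff | reflexivity|].
        destruct q as [a b c], e as [a' b' c']; unfold rat_le in *; simpl in *.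
        apply le_iff in H1; destruct H1 as [w Hw]; apply le_iff; exists w.
        revert Hw; match goal with |- ?s = ?t -> ?s' = ?t' =>
          replace s with s' by ring; replace t with t' by ring; auto end. }
      destruct Hq as [[Hxy _] | [_ [v [-> _]]]]; auto.
      exfalso; unfold rat_le in L; simpl in L; apply le_iff in L; destruct L as [w Hw].
      apply (succ_neq0 (RCA0_basic HM) (n := w)).
      transitivity (1 * (0 + 1) + 0 * (v + 1) + w); [ring|]. rewrite <- Hw; ring.
    + intros ->; intros k p q e; rewrite dist_iff; intros [_ [_ Hp]] -> He.
      destruct Hp as [[_ ->] | [H _]]; [|congruence].
      apply rat_dist_le_refl; exact (inv_pow2_ge0 He).
  - intros x y Hx Hy k p q e; rewrite !dist_iff; intros [_ [_ Hp]] [_ [_ Hq]] He.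
    rewrite (close_value_unique Hp (close_value_sym Hq)).
    apply rat_dist_le_refl; exact (inv_pow2_ge0 He).
  - intros x y z Hx Hy Hz k p q e; rewrite !dist_iff; intros [_ [_ Hp]] Hq He.
    destruct Hq as [p1 [p2 [H1 [H2 ->]]]]; rewrite dist_iff in H1, H2.
    apply rat_le_add_r; [exact (inv_pow2_ge0 He)|].
    apply close_value_triangle with (x := x) (y := y) (z := z); tauto.
Qed.

Lemma dist_lt_iff x y q (e : rat M) : X x -> X y -> close_value close x y q ->
  (real_lt (dist d x y) (real_of_rat e) <-> ~ rat_le e q).
Proof.
  intros Hx Hy Hq; unfold real_lt, real_le, real_of_rat; split; intros H L; apply H.
  - intros k p q' e' ->; rewrite dist_iff; intros [_ [_ Hq']] He.
    rewrite (close_value_unique Hq' Hq); apply rat_le_add_r; auto.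
    exact (inv_pow2_ge0 He).
  - apply rat_le_archimedean; intros k e' He.
    apply (L k e q e'); auto. apply dist_iff; auto.
Qed.

Lemma dist_lt_close x y b : X x -> X y ->
  real_lt (dist d x y) (real_of_rat (Rat 1 0 b)) -> x = y \/ close x y b.
Proof.
  intros Hx Hy; destruct (close_value_exists Hx Hy) as [q Hq].
  rewrite (dist_lt_iff _ Hx Hy Hq); intros H.
  destruct Hq as [[Hxy _] | [_ [v [-> [Hv _]]]]]; auto.
  right; apply (close_le Hclose) with (v := v); auto.
  apply NNPP; intros Hb; apply H; unfold rat_le; simpl.
  apply not_le, lt_iff in Hb; destruct Hb as [d' ->]; apply le_iff; exists (d' + 1); ring.
Qed.

Lemma close_dist_lt (e : rat M) : rat_lt (rat0 M) e -> exists b, forall x y, X x -> X y ->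
  x = y \/ close x y b -> real_lt (dist d x y) (real_of_rat e).
Proof.
  (* A positive [e] is at least [1 / (rden e + 1)], while closeness at level [rden e + 1] means
     distance at most [1 / (rden e + 2)]. *)
  intros He; exists (rden e + 1); intros x y Hx Hy Hxy.
  destruct (close_value_exists Hx Hy) as [q Hq]; rewrite (dist_lt_iff _ Hx Hy Hq).
  destruct Hq as [[_ ->] | [Hne [v [-> [H1 H2]]]]]; [exact He|].
  destruct Hxy as [Hxy | Hxy]; [contradiction|].
  apply (close_value_le _ H1 H2) in Hxy.
  destruct e as [a b c]; unfold rat_lt, rat_le in *; simpl in *.
  apply not_le, lt_iff in He; destruct He as [u Hu].
  apply le_iff in Hxy; destruct Hxy as [w ->].
  intros L; apply le_iff in L; destruct L as [s Hs].
  assert (Ea : a = b + u + 1).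
  { transitivity (a * (0 + 1) + 0 * (c + 1)); [ring|]. rewrite Hu; ring. }
  subst a; clear Hu.
  apply (succ_neq0 (RCA0_basic HM) (n := (u * (c + 1 + w + 1) + w + s))).
  apply add_cancel_l with (k := b * (c + 1 + w + 1) + c + 1).
  transitivity ((b + u + 1) * (c + 1 + w + 1) + 0 * (c + 1) + s); [ring|].
  rewrite <- Hs; ring.
Qed.

Lemma complete_iff : complete X d <-> close_complete X close.
Proof.
  assert (HX : forall a : nset M, is_function (all_num (M := M)) X a ->
    forall n x, a (pair n x) -> X x).
  { intros a [[Ha _] _] n x H; destruct (Ha _ H) as [n' [x' [E [_ H']]]]; pair_inv; auto. }
  split; intros H a Ha Hc; specialize (HX a Ha).
  - destruct (H a Ha) as [x [Hx Hconv]].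
    + intros e He; destruct (close_dist_lt He) as [b Hb]; destruct (Hc b) as [n0 Hn0].
      exists n0; intros m n x y Hm Hn Hmx Hny; apply Hb; eauto.
    + exists x; split; auto; intros b; destruct (Hconv (Rat 1 0 b)) as [n0 Hn0].
      { unfold rat_lt, rat_le; simpl; rewrite not_le; apply lt_iff; exists 0; ring. }
      exists n0; intros n y Hn Hny; apply dist_lt_close; eauto.
  - destruct (H a Ha) as [x [Hx Hconv]].
    + intros b; destruct (Hc (Rat 1 0 b)) as [n0 Hn0].
      { unfold rat_lt, rat_le; simpl; rewrite not_le; apply lt_iff; exists 0; ring. }
      exists n0; intros m n x y Hm Hn Hmx Hny; apply dist_lt_close; eauto.
    + exists x; split; auto; intros e He; destruct (close_dist_lt He) as [b Hb].
      destruct (Hconv b) as [n0 Hn0]; exists n0; intros n y Hn Hny; apply Hb; eauto.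
Qed.

End OneSpace.

Lemma close_complete_index_set (X A : nset M) :
  complete_index_set_exists M ->
  (forall i, closeness (section X i) (fun x y b => A (pair (pair (pair x y) b) i))) ->
  exists Z : nset M, forall i, Z i <->
    close_complete (section X i) (fun x y b => A (pair (pair (pair x y) b) i)).
Proof.
  intros HC HA.
  destruct (@comprehension2 M HM (fun n i =>
    exists x, x < n + 1 /\ exists y, y < n + 1 /\ exists k, k < n + 1 /\
    exists u, u < n + 1 /\ exists v, v < n + 1 /\
      (n = pair (pair (pair x y) k) (pair (pair u 0) v) /\ X (pair x i) /\ X (pair y i) /\
       ((x = y /\ u = 0 /\ v = 0) \/ (x <> y /\ u = 1 /\ A (pair (pair (pair x y) v) i) /\
          ~ A (pair (pair (pair x y) (v + 1)) i)))))) as [d [Hd _]]; [definable|].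
  assert (Hd' : forall i n, section d i n <-> exists x y k q,
    n = pair (pair (pair x y) k) (rat_code q) /\ section X i x /\ section X i y /\
      close_value (fun x y b => A (pair (pair (pair x y) b) i)) x y q).
  { intros i n; unfold section; rewrite Hd; split.
    - intros [x [_ [y [_ [k [_ [u [_ [v [_ [-> [Hx [Hy H]]]]]]]]]]]]].
      exists x, y, k, (Rat u 0 v); repeat (split; auto).
      destruct H as [[-> [-> ->]] | [Hxy [-> H]]]; [left; auto | right; split; auto].
      exists v; auto.
    - intros [x [y [k [[u u' v] [-> [Hx [Hy H]]]]]]]; unfold rat_code; simpl.
      assert (u' = 0) by exact (close_value_ge0 H); subst u'.
      exists x; split.
      { apply lt_succ_le; do 2 (eapply le_trans; [|apply le_pair_l]); apply le_pair_l. }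
      exists y; split.
      { apply lt_succ_le; do 2 (eapply le_trans; [|apply le_pair_l]); apply le_pair_r. }
      exists k; split.
      { apply lt_succ_le; eapply le_trans; [|apply le_pair_l]; apply le_pair_r. }
      exists u; split.
      { apply lt_succ_le; eapply le_trans; [|apply le_pair_r].
        eapply le_trans; [|apply le_pair_l]; apply le_pair_l. }
      exists v; split.
      { apply lt_succ_le; eapply le_trans; [|apply le_pair_r]; apply le_pair_r. }
      repeat (split; auto).
      destruct H as [[Hxy E] | [Hxy [w [E H]]]]; injection E; intros; subst; auto. }
  assert (Hset : forall i x y, exists S : nset M, forall b, S b <-> A (pair (pair (pair x y) b) i)).
  { intros i x y; apply (@comprehension M HM (fun b => A (pair (pair (pair x y) b) i))); definable. }
  destruct (HC X d) as [Z HZ].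
  - intros i; exact (closeness_metric (HA i) (Hset i) (Hd' i)).
  - exists Z; intros i; rewrite HZ; exact (complete_iff (HA i) (Hset i) (Hd' i)).
Qed.

End Ultrametric.

(** * Sigma^0_1 comprehension *)

Definition Sigma01_comprehension (M : L2structure) : Prop :=
  forall A : nset M, exists Z : nset M, forall n, Z n <-> exists m, A (pair n m).

Section Jump.
Context {M : L2structure} {HM : RCA0 M}.
Implicit Types b i k m n u v w x y z : M.

(* The [i]-th space is the initial segment below the least [m] with
   [A (pair i m)]; it is all of [M] when there is no such [m]. *)
Lemma initial_segments (A : nset M) : exists X : nset M, forall x i,
  X (pair x i) <-> forall m, m < x + 1 -> ~ A (pair i m).
Proof.
  destruct (@comprehension2 M HM (fun x i => forall m, m < x + 1 -> ~ A (pair i m))) as [X [HX _]];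
    [definable | eauto].
Qed.

Lemma scattered_Sigma01_comprehension :
  scattered_index_set_exists M -> Sigma01_comprehension M.
Proof.
  intros HS A; destruct (initial_segments A) as [X HX].
  destruct (@comprehension3 M HM (fun x y _ => x < y)) as [R [HR _]]; [definable|].
  destruct (@noetherian_index_set M HM X R HS) as [Z HZ].
  - intros i x y z; rewrite !HR; apply lt_trans.
  - intros i x; rewrite HR; apply lt_irrefl.
  - exists Z; intros i; rewrite HZ; split.
    + intros H; apply NNPP; intros HA.
      destruct (@comprehension M HM (fun _ => True)) as [Y HY]; [definable|].
      destruct (H Y) as [x [_ Hx]].
      * intros x _; apply HX; intros m _ Hm; eauto.
      * exists 0; now apply HY.
      * apply (Hx (x + 1)); [now apply HY | apply HR, lt_self].
    + intros [m Hm] Y HY [x0 Hx0]; apply NNPP; intros H.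
      (* A nonempty set without a greatest element is unbounded, but all points lie below [m]. *)
      assert (K : forall n, exists y, Y y /\ n <= y).
      { apply Sigma_induction; [definable | |].
        - exists x0; split; auto; apply le_0.
        - intros n [y [Hy Hn]]; apply NNPP; intros H'; apply H; exists y; split; auto.
          intros z Hz; rewrite HR; intros Hyz; apply H'; exists z; split; auto.
          apply le_succ_lt; ord. }
      destruct (K m) as [y [Hy Hmy]]; apply HY in Hy; rewrite HX in Hy.
      apply (Hy m); auto; now apply lt_succ_le.
Qed.

Lemma complete_Sigma01_comprehension :
  complete_index_set_exists M -> Sigma01_comprehension M.
Proof.
  intros HC A; destruct (initial_segments A) as [X HX].
  destruct (@comprehension4 M HM (fun x y b _ => b <= x /\ b <= y)) as [D [HD _]]; [definable|].
  destruct (@close_complete_index_set M HM X D HC) as [Z HZ].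
  - intros i; split.
    + intros x y _ _; apply HD; split; apply le_0.
    + intros x y u v Huv; rewrite !HD; intros [H1 H2]; split; ord.
    + intros x y _ _; exists (x + 1); rewrite HD; intros [H _]; ord.
    + intros x y b; rewrite !HD; tauto.
    + intros x y z b; rewrite !HD; tauto.
  - exists Z; intros i; rewrite HZ; split.
    + intros H; apply NNPP; intros HA.
      (* The sequence 0, 1, 2, ... is Cauchy, and nothing is close to [x] at level [x + 1]. *)
      destruct (@comprehension2 M HM (fun x y => x = y)) as [a [Ha Ha2]]; [definable|].
      destruct (H a) as [x [_ Hx]].
      * split; [split|].
        -- intros p Hp; destruct (Ha2 p Hp) as [x [y ->]]; exists x, y; repeat split.
           apply HX; intros m _ Hm; eauto.
        -- intros x y z; rewrite !Ha; congruence.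
        -- intros x _; exists x; now apply Ha.
      * intros b; exists b; intros m n x y Hm Hn; rewrite !Ha, HD; intros -> ->; auto.
      * destruct (Hx (x + 1)) as [n0 Hn0]; destruct (upper_bound n0 (x + 1)) as [n [H1 H2]].
        destruct (Hn0 n n) as [E | E]; auto; [now apply Ha | |].
        -- subst; ord.
        -- apply HD in E; destruct E as [_ E]; ord.
    (* All points lie below [m], so closeness at level [m] is impossible and the sequence is
       constant from [n0] on. *)
    + intros [m Hm] a [[Ha _] Ha2] Hc; destruct (Hc m) as [n0 Hn0].
      assert (HaX : forall n x, a (pair n x) -> section X i x /\ x < m).
      { intros n x H; destruct (Ha _ H) as [n' [x' [E [_ Hx']]]]; pair_inv.
        split; auto; apply NNPP; intros Hxm; apply not_lt in Hxm.
        unfold section in Hx'; rewrite HX in Hx'.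
        apply (Hx' m); auto; now apply lt_succ_le. }
      destruct (Ha2 n0) as [x Hx]; [exact I|].
      destruct (HaX _ _ Hx) as [HxX Hxm].
      exists x; split; auto; intros b; exists n0; intros n y Hn Hny; left.
      destruct (Hn0 n n0 y x) as [E | E]; auto.
      apply HD in E; destruct E as [_ E]; ord.
Qed.

End Jump.

(** * Clauses *)

Section NormalForm.
Context {M : L2structure} {HM : RCA0 M}.
Hypothesis HJ : Sigma01_comprehension M.
Implicit Types (b c i k m n r u v w x y z : M) (G T H X : nset M).

(* A literal is a number [pair v 0], for [v], or [pair v 1], for the negation
   of [v].  A set [T] is a family of infinitary clauses: the [m]-th clause is
   the disjunction of the literals [k] with [T (pair m k)]. *)
Definition lit (G : M -> Prop) k := exists v, (k = pair v 0 /\ G v) \/ (k = pair v 1 /\ ~ G v).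

Definition models G T := forall m, exists k, T (pair m k) /\ lit G k.

(* The variables are grouped by a tag: [pair c i] is the [c]-th variable with
   tag [i]. *)
Definition tagged r k :=
  exists c i b, k = pair (pair c i) b /\ i < r /\ (b = 0 \/ b = 1).

(** The tags below [r] may be in use and [r] is free for the next definition; tag 0 is reserved for
    the set [X]. *)
Definition wf r T := 0 < r /\ forall m k, T (pair m k) -> tagged r k.

(** Two complementary literals: a clause with both always holds. It fills the indices that carry no
    clause, since [models] speaks of all indices. *)
Definition tautology k := k = pair (pair 0 0) 0 \/ k = pair (pair 0 0) 1.

Lemma zero_neq_one : (0 : M) <> 1.
Proof.
  intros E; apply (succ_neq0 (RCA0_basic HM) (n := 0)); now rewrite add_0_l.
Qed.

Lemma lit_pos (G : M -> Prop) v : lit G (pair v 0) <-> G v.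
Proof.
  split; [|exists v; auto].
  intros [u [[E HG] | [E HG]]]; pair_inv; auto. now apply zero_neq_one in H0.
Qed.

Lemma lit_neg (G : M -> Prop) v : lit G (pair v 1) <-> ~ G v.
Proof.
  split; [|exists v; auto].
  intros [u [[E HG] | [E HG]]]; pair_inv; auto. symmetry in H0; now apply zero_neq_one in H0.
Qed.

Lemma tautology_sat (G : M -> Prop) : exists k, tautology k /\ lit G k.
Proof.
  destruct (classic (G (pair 0 0))) as [HG | HG].
  - exists (pair (pair 0 0) 0); split; [left; auto | now apply lit_pos].
  - exists (pair (pair 0 0) 1); split; [right; auto | now apply lit_neg].
Qed.

Lemma tautology_tagged r k : 0 < r -> tautology k -> tagged r k.
Proof. intros Hr [-> | ->]; exists 0, 0; eexists; repeat split; eauto. Qed.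

Lemma tagged_mono r r' k : r <= r' -> tagged r k -> tagged r' k.
Proof.
  intros Hr [c [i [b [E [Hi Hb]]]]]; exists c, i, b; repeat split; auto.
  exact (lt_le_trans Hi Hr).
Qed.

Lemma lit_agree r k (G G' : M -> Prop) :
  (forall c i, i < r -> (G (pair c i) <-> G' (pair c i))) -> tagged r k ->
  (lit G k <-> lit G' k).
Proof.
  intros HG [c [i [b [-> [Hi [-> | ->]]]]]].
  - rewrite !lit_pos; auto.
  - rewrite !lit_neg, (HG c i Hi); tauto.
Qed.

Lemma models_on r (D T : nset M) :
  0 < r -> (forall m k, D m -> T (pair m k) -> tagged r k) ->
  exists T', wf r T' /\
    forall G, models G T' <-> forall m, D m -> exists k, T (pair m k) /\ lit G k.
Proof.
  intros Hr HT.
  destruct (@comprehension2 M HM (fun m k => (D m /\ T (pair m k)) \/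
    (~ D m /\ (k = pair (pair 0 0) 0 \/ k = pair (pair 0 0) 1)))) as [T' [HT' _]]; [definable|].
  exists T'; split; [split; auto|].
  - intros m k Hk; apply HT' in Hk; destruct Hk as [[Hm Hk] | [_ Hk]]; eauto.
    now apply tautology_tagged.
  - intros G; split; intros HG m.
    + intros Hm; destruct (HG m) as [k [Hk Hl]]; rewrite HT' in Hk.
      exists k; tauto.
    + destruct (classic (D m)) as [Hm | Hm].
      * destruct (HG m Hm) as [k [Hk Hl]]; exists k; rewrite HT'; auto.
      * destruct (tautology_sat G) as [k [Hk Hl]]; exists k; rewrite HT'; auto.
Qed.

Lemma models_and r (T1 T2 : nset M) : wf r T1 -> wf r T2 ->
  exists T, wf r T /\ forall G, models G T <-> models G T1 /\ models G T2.
Proof.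
  intros [Hr H1] [_ H2].
  destruct (@comprehension2 M HM (fun m k =>
    (exists m', m' < m + 1 /\ (m = pair m' 0 /\ T1 (pair m' k))) \/
    (exists m', m' < m + 1 /\ (m = pair m' 1 /\ T2 (pair m' k))))) as [T [HT _]]; [definable|].
  destruct (@comprehension M HM (fun m => exists m', m' < m + 1 /\
    (m = pair m' 0 \/ m = pair m' 1))) as [D HD]; [definable|].
  destruct (@models_on r D T Hr) as [T' [Hwf HT']].
  - intros m k _ Hk; apply HT in Hk.
    destruct Hk as [[m' [_ [_ Hk]]] | [m' [_ [_ Hk]]]]; eauto.
  - exists T'; split; auto; intros G; rewrite HT'; split.
    + intros HG; split; intros m.
      * destruct (HG (pair m 0)) as [k [Hk Hl]].
        { apply HD; exists m; split; [apply lt_pair_l | auto]. }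
        exists k; split; auto; apply HT in Hk.
        destruct Hk as [[m' [_ [E Hk]]] | [m' [_ [E Hk]]]]; pair_inv; auto.
        now apply zero_neq_one in H0.
      * destruct (HG (pair m 1)) as [k [Hk Hl]].
        { apply HD; exists m; split; [apply lt_pair_l | auto]. }
        exists k; split; auto; apply HT in Hk.
        destruct Hk as [[m' [_ [E Hk]]] | [m' [_ [E Hk]]]]; pair_inv; auto.
        symmetry in H0; now apply zero_neq_one in H0.
    + intros [HG1 HG2] m Hm; apply HD in Hm; destruct Hm as [m' [Hm' [-> | ->]]].
      * destruct (HG1 m') as [k [Hk Hl]]; exists k; split; auto; apply HT; left; eauto.
      * destruct (HG2 m') as [k [Hk Hl]]; exists k; split; auto; apply HT; right; eauto.
Qed.

(** Conservative extension: models of [T] extend to models of [T'] without change on the tags below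
    [r]. *)
Definition ext r T r' T' :=
  r <= r' /\ (forall G, models G T' -> models G T) /\
  forall G, models G T -> exists G', models G' T' /\
    forall c i, i < r -> (G' (pair c i) <-> G (pair c i)).

Lemma ext_trans r T r' T' r'' T'' : ext r T r' T' -> ext r' T' r'' T'' -> ext r T r'' T''.
Proof.
  intros [H1 [H2 H3]] [H1' [H2' H3']]; split; [exact (le_trans H1 H1')|]; split; auto.
  intros G HG; destruct (H3 G HG) as [G' [HG' E]]; destruct (H3' G' HG') as [G'' [HG'' E']].
  exists G''; split; auto; intros c i Hi; rewrite <- E, <- E'; try tauto.
  exact (lt_le_trans Hi H1).
Qed.

(* Tseitin's clauses, which define the variables of a new tag [r]: the [c]-th
   one is the disjunction of the literals [k] with [H (pair c k)]. *)
Lemma define_tag r T H : wf r T -> (forall c k, H (pair c k) -> tagged r k) ->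
  exists T', wf (r + 1) T' /\ ext r T (r + 1) T' /\
    forall G, models G T' -> forall c, G (pair c r) <-> exists k, H (pair c k) /\ lit G k.
Proof.
  intros Hwf HH; destruct Hwf as [Hr HT].
  assert (Hr' : 0 < r + 1) by (pose proof (lt_self r); ord).
  assert (Hrr : r <= r + 1) by (left; apply lt_self).
  (* The clauses for one direction: the new variable implies the disjunction. *)
  destruct (@comprehension2 M HM (fun c k => k = pair (pair c r) 1 \/ H (pair c k)))
    as [T1 [HT1 _]]; [definable|].
  (* The clauses for the converse, one for each literal [h] of the disjunction: the new variable or
     the negation of [h]. *)
  destruct (@comprehension2 M HM (fun m k => exists c, c < m + 1 /\ exists h, h < m + 1 /\
    (m = pair c h /\ (k = pair (pair c r) 0 \/ exists v, v < h + 1 /\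
      ((h = pair v 0 /\ k = pair v 1) \/ (h = pair v 1 /\ k = pair v 0))))))
    as [T2 [HT2 _]]; [definable|].
  destruct (@comprehension M HM (fun _ => True)) as [D1 HD1]; [definable|].
  destruct (@models_on (r + 1) D1 T1 Hr') as [T1' [Hwf1 HT1']].
  { intros c k _ Hk; apply HT1 in Hk; destruct Hk as [-> | Hk].
    - exists c, r, 1; repeat split; auto; apply lt_self.
    - exact (tagged_mono Hrr (HH _ _ Hk)). }
  destruct (@comprehension2 M HM (fun c h => H (pair c h))) as [D2 [HD2 HD2']]; [definable|].
  destruct (@models_on (r + 1) D2 T2 Hr') as [T2' [Hwf2 HT2']].
  { intros m k Hm Hk; apply HT2 in Hk.
    destruct Hk as [c [_ [h [_ [-> [-> | [v [_ Hk]]]]]]]]; apply HD2 in Hm.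
    - exists c, r, 0; repeat split; auto; apply lt_self.
    - apply (tagged_mono Hrr); destruct (HH _ _ Hm) as [c' [i [b [E [Hi Hb]]]]].
      destruct Hk as [[-> ->] | [-> ->]]; pair_inv; exists c', i; eexists; repeat split; eauto. }
  destruct (@models_and (r + 1) T1' T2' Hwf1 Hwf2) as [T12 [Hwf12 HT12]].
  destruct (@models_and (r + 1) T T12) as [T' [Hwf' HT']]; auto.
  { split; auto; intros m k Hk; exact (tagged_mono Hrr (HT _ _ Hk)). }
  assert (K : forall G, models G T' <-> models G T /\
    forall c, G (pair c r) <-> exists k, H (pair c k) /\ lit G k).
  { intros G; rewrite HT', HT12, HT1', HT2'; split.
    - intros [HG [H1 H2]]; split; auto; intros c; split.
      + intros Hc; destruct (H1 c) as [k [Hk Hl]]; [now apply HD1|].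
        apply HT1 in Hk; destruct Hk as [-> | Hk]; [|eauto].
        now rewrite lit_neg in Hl.
      + intros [h [Hh Hl]]; destruct (H2 (pair c h)) as [k [Hk Hl']]; [now apply HD2|].
        apply HT2 in Hk; destruct Hk as [c' [_ [h' [_ [E Hk]]]]]; pair_inv.
        destruct Hk as [-> | [v [_ [[-> ->] | [-> ->]]]]]; rewrite ?lit_pos, ?lit_neg in *; tauto.
    - intros [HG Hc]; split; auto; split.
      + intros c _; destruct (classic (G (pair c r))) as [HGc | HGc].
        * apply Hc in HGc; destruct HGc as [k [Hk Hl]]; exists k; split; auto.
          apply HT1; auto.
        * exists (pair (pair c r) 1); split; [apply HT1; auto | now apply lit_neg].
      + intros m Hm; destruct (HD2' _ Hm) as [c [h ->]]; apply HD2 in Hm.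
        destruct (classic (G (pair c r))) as [HGc | HGc].
        * exists (pair (pair c r) 0); split; [|now apply lit_pos].
          apply HT2; exists c; split; [apply lt_pair_l|].
          exists h; split; [apply lt_pair_r | auto].
        * assert (Hl : ~ lit G h) by (intros Hl; apply HGc, Hc; eauto).
          destruct (HH _ _ Hm) as [c' [i [b [E [_ Hb]]]]].
          assert (F : exists k, lit G k /\ ((h = pair (pair c' i) 0 /\ k = pair (pair c' i) 1) \/
            (h = pair (pair c' i) 1 /\ k = pair (pair c' i) 0))).
          { destruct Hb as [-> | ->]; subst h; rewrite ?lit_pos, ?lit_neg in Hl.
            - exists (pair (pair c' i) 1); rewrite lit_neg; auto.
            - exists (pair (pair c' i) 0); rewrite lit_pos; split; auto. now apply NNPP. }
          destruct F as [k [Hk F]]; exists k; split; auto; apply HT2.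
          exists c; split; [apply lt_pair_l|]; exists h; split; [apply lt_pair_r|].
          split; auto; right; exists (pair c' i); split; auto.
          rewrite E; apply lt_pair_l. }
  exists T'; split; [auto|split; [split; [auto|split]|]].
  - intros G HG; now apply K in HG.
  - intros G HG.
    (* The value of an infinite disjunction is a Sigma^0_1 condition on [G], whence the appeal to
       [HJ]. *)
    destruct (@comprehension2 M HM (fun c k => H (pair c k) /\ exists v, v < k + 1 /\
      ((k = pair v 0 /\ G v) \/ (k = pair v 1 /\ ~ G v)))) as [A [HA _]]; [definable|].
    destruct (HJ A) as [Z HZ].
    destruct (@comprehension2 M HM (fun c i => (i <> r /\ G (pair c i)) \/ (i = r /\ Z c)))
      as [G' [HG' _]]; [definable|].
    assert (E : forall c i, i < r -> (G' (pair c i) <-> G (pair c i))).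
    { intros c i Hi; rewrite HG'; split; [|left; split; auto; intros ->; now apply lt_irrefl in Hi].
      intros [[_ H1] | [-> _]]; auto. now apply lt_irrefl in Hi. }
    exists G'; split; auto; apply K; split.
    + intros m; destruct (HG m) as [k [Hk Hl]]; exists k; split; auto.
      revert Hl; apply (lit_agree (r := r)); eauto.
    + intros c; rewrite HG'; transitivity (Z c); [tauto|]. rewrite HZ; split.
      * intros [k Hk]; apply HA in Hk; destruct Hk as [Hk [v [_ Hl]]]; exists k; split; auto.
        rewrite (lit_agree (r := r) (G' := G)); eauto. exists v; auto.
      * intros [k [Hk Hl]]; exists k; apply HA; split; auto.
        rewrite (lit_agree (r := r) (G' := G)) in Hl; eauto.
        destruct Hl as [v Hl]; exists v; split; auto.
        destruct Hl as [[-> _] | [-> _]]; apply lt_pair_l.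
  - intros G HG; now apply K in HG.
Qed.


(** Indexes the variable that stands for an instance of a formula with [N] free number variables.
    [N] is a standard number, so the recursion takes place outside [M]. *)
Fixpoint code (N : nat) (e : nat -> M) : M :=
  match N with O => 0 | S N => pair (e O) (code N (fun j => e (S j))) end.

Lemma Sigma_comprehension2 (P : M -> M -> M -> Prop) :
  rep Sigma00 3 (fun e _ => P (e 2%nat) (e 1%nat) (e O)) ->
  exists Z : nset M, forall a b, Z (pair a b) <-> exists m, P a b m.
Proof.
  intros HP; destruct (comprehension3 HP) as [A [HA _]]; destruct (HJ A) as [Z HZ].
  exists Z; intros a b; rewrite HZ; split; intros [m Hm]; exists m; now apply HA.
Qed.

Lemma var_values (N : nat) : forall (p : nat -> M) (i : nat), exists V : nset M,
  forall e y, V (pair (code N e) y) <-> y = glue N e p i.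
Proof.
  induction N as [|N IH]; intros p i; simpl.
  - destruct (@comprehension2 M HM (fun _ y => y = p i)) as [V [HV _]]; [definable|].
    exists V; intros e y; apply HV.
  - destruct i as [|i]; simpl.
    + destruct (@comprehension2 M HM (fun c y => exists z, z < c + 1 /\ c = pair y z))
        as [V [HV _]]; [definable|].
      exists V; intros e y; rewrite HV; split.
      * intros [z [_ E]]; pair_inv; auto.
      * intros ->; eexists; split; [apply lt_pair_r | reflexivity].
    + destruct (IH p i) as [W HW].
      destruct (@comprehension2 M HM (fun c y => exists x, x < c + 1 /\ exists z, z < c + 1 /\
        (c = pair x z /\ W (pair z y)))) as [V [HV _]]; [definable|].
      exists V; intros e y; rewrite HV, <- HW; split.
      * intros [x [_ [z [_ [E H]]]]]; pair_inv; auto.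
      * intros H; exists (e O); split; [apply lt_pair_l|].
        eexists; split; [apply lt_pair_r|]; eauto.
Qed.

(** Evaluation by recursion on the external term; the values of the immediate subterms are the
    unbounded witnesses. *)
Lemma term_values (N : nat) (p : nat -> M) (t : term) : exists V : nset M,
  forall e y, V (pair (code N e) y) <-> y = eval (glue N e p) t.
Proof.
  induction t as [i | | | t [V HV] u [W HW] | t [V HV] u [W HW]]; simpl.
  - apply var_values.
  - destruct (@comprehension2 M HM (fun _ y => y = 0)) as [V [HV _]]; [definable|].
    exists V; intros e y; apply HV.
  - destruct (@comprehension2 M HM (fun _ y => y = 1)) as [V [HV _]]; [definable|].
    exists V; intros e y; apply HV.
  - destruct (@Sigma_comprehension2 (fun c y m => exists a, a < m + 1 /\ exists b, b < m + 1 /\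
      (m = pair a b /\ V (pair c a) /\ W (pair c b) /\ y = a + b))) as [Z HZ]; [definable|].
    exists Z; intros e y; rewrite HZ; split.
    + intros [m [a [_ [b [_ [_ [Ha [Hb ->]]]]]]]]; apply HV in Ha; apply HW in Hb; congruence.
    + intros ->; eexists (pair (eval (glue N e p) t) (eval (glue N e p) u)), _.
      split; [apply lt_pair_l|]; eexists; split; [apply lt_pair_r|].
      repeat split; [now apply HV | now apply HW].
  - destruct (@Sigma_comprehension2 (fun c y m => exists a, a < m + 1 /\ exists b, b < m + 1 /\
      (m = pair a b /\ V (pair c a) /\ W (pair c b) /\ y = a * b))) as [Z HZ]; [definable|].
    exists Z; intros e y; rewrite HZ; split.
    + intros [m [a [_ [b [_ [_ [Ha [Hb ->]]]]]]]]; apply HV in Ha; apply HW in Hb; congruence.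
    + intros ->; eexists (pair (eval (glue N e p) t) (eval (glue N e p) u)), _.
      split; [apply lt_pair_l|]; eexists; split; [apply lt_pair_r|].
      repeat split; [now apply HV | now apply HW].
Qed.

(* Every clause family extends to one in which some tag holds the truth values
   of the predicate, the variables with tag [0] being those of the set [X]. *)
Definition clausal (N : nat) (P : (nat -> M) -> nset M -> Prop) : Prop :=
  forall r T, wf r T -> exists r' T', wf r' T' /\ ext r T r' T' /\
    exists i, i < r' /\ forall G, models G T' ->
      forall X, (forall x, X x <-> G (pair x 0)) ->
        forall e, G (pair (code N e) i) <-> P e X.

Lemma clausal_iff N P Q : (forall e X, P e X <-> Q e X) -> clausal N P -> clausal N Q.
Proof.
  intros E HP r T Hwf; destruct (HP r T Hwf) as [r' [T' [Hwf' [He [i [Hi H]]]]]].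
  exists r', T'; repeat (split; auto); exists i; split; auto.
  intros G HG X HX e; rewrite <- E; now apply H.
Qed.

Lemma clausal_define N P r T H : wf r T -> (forall c k, H (pair c k) -> tagged r k) ->
  (forall G, models G T -> forall X, (forall x, X x <-> G (pair x 0)) ->
     forall e, (exists k, H (pair (code N e) k) /\ lit G k) <-> P e X) ->
  exists r' T', wf r' T' /\ ext r T r' T' /\
    exists i, i < r' /\ forall G, models G T' ->
      forall X, (forall x, X x <-> G (pair x 0)) ->
        forall e, G (pair (code N e) i) <-> P e X.
Proof.
  intros Hwf HH HP; destruct (define_tag Hwf HH) as [T' [Hwf' [He HT']]].
  exists (r + 1), T'; repeat (split; auto); try apply He.
  exists r; split; [apply lt_self|]; intros G HG X HX e.
  rewrite (HT' G HG); apply HP; auto; now apply He.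
Qed.

(** Truth values that do not depend on [X] are known in advance: the defining disjunction is either
    [tautology] or empty. *)
Lemma clausal_set N (A : nset M) (P : (nat -> M) -> Prop) :
  (forall e, A (code N e) <-> P e) -> clausal N (fun e _ => P e).
Proof.
  intros HA r T Hwf.
  destruct (@comprehension2 M HM (fun c k => A c /\ (k = pair (pair 0 0) 0 \/
    k = pair (pair 0 0) 1))) as [H [HH _]]; [definable|].
  apply (clausal_define (H := H)); auto.
  - intros c k Hk; apply HH in Hk; destruct Hk as [_ Hk].
    apply tautology_tagged; auto; apply Hwf.
  - intros G HG X HX e; rewrite <- HA; split.
    + intros [k [Hk _]]; apply HH in Hk; tauto.
    + intros Hc; destruct (tautology_sat G) as [k [Hk Hl]]; exists k; split; auto.
      apply HH; auto.
Qed.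

Lemma clausal_mem N (V : nset M) (x : (nat -> M) -> M) :
  (forall e y, V (pair (code N e) y) <-> y = x e) -> clausal N (fun e X => X (x e)).
Proof.
  intros HV r T Hwf.
  destruct (@comprehension2 M HM (fun c k => exists y, y < k + 1 /\
    (k = pair (pair y 0) 0 /\ V (pair c y)))) as [H [HH _]]; [definable|].
  apply (clausal_define (H := H)); auto.
  - intros c k Hk; apply HH in Hk; destruct Hk as [y [_ [-> _]]].
    exists y, 0, 0; repeat split; auto; apply Hwf.
  - intros G HG X HX e; rewrite HX; split.
    + intros [k [Hk Hl]]; apply HH in Hk; destruct Hk as [y [_ [-> Hy]]].
      apply HV in Hy; subst y; now rewrite lit_pos in Hl.
    + intros Hx; exists (pair (pair (x e) 0) 0); rewrite lit_pos; split; auto.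
      apply HH; exists (x e); split; [|split; auto; now apply HV].
      apply lt_succ_le; eapply le_trans; [|apply le_pair_l]; apply le_pair_l.
Qed.

Lemma clausal_not N P : clausal N P -> clausal N (fun e X => ~ P e X).
Proof.
  intros HP r T Hwf; destruct (HP r T Hwf) as [r1 [T1 [Hwf1 [He1 [i [Hi H1]]]]]].
  destruct (@comprehension2 M HM (fun c k => k = pair (pair c i) 1)) as [H [HH _]]; [definable|].
  destruct (@clausal_define N (fun e X => ~ P e X) r1 T1 H Hwf1)
    as [r2 [T2 [Hwf2 [He2 H2]]]].
  - intros c k Hk; apply HH in Hk; exists c, i, 1; auto.
  - intros G HG X HX e; rewrite <- (H1 G HG X HX); split.
    + intros [k [Hk Hl]]; apply HH in Hk; subst k; now rewrite lit_neg in Hl.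
    + intros Hn; exists (pair (pair (code N e) i) 1); rewrite lit_neg; split; auto; now apply HH.
  - exists r2, T2; split; auto; split; auto; exact (ext_trans He1 He2).
Qed.

Lemma clausal_or N P Q : clausal N P -> clausal N Q -> clausal N (fun e X => P e X \/ Q e X).
Proof.
  intros HP HQ r T Hwf; destruct (HP r T Hwf) as [r1 [T1 [Hwf1 [He1 [i [Hi H1]]]]]].
  destruct (HQ r1 T1 Hwf1) as [r2 [T2 [Hwf2 [He2 [j [Hj H2]]]]]].
  destruct (@comprehension2 M HM (fun c k => k = pair (pair c i) 0 \/ k = pair (pair c j) 0))
    as [H [HH _]]; [definable|].
  destruct (@clausal_define N (fun e X => P e X \/ Q e X) r2 T2 H Hwf2)
    as [r3 [T3 [Hwf3 [He3 H3]]]].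
  - intros c k Hk; apply HH in Hk; destruct Hk as [-> | ->].
    + exists c, i, 0; repeat split; auto. destruct He2 as [Hr _]; exact (lt_le_trans Hi Hr).
    + exists c, j, 0; auto.
  - intros G HG X HX e; rewrite <- (H2 G HG X HX).
    rewrite <- (H1 G (proj1 (proj2 He2) G HG) X HX); split.
    + intros [k [Hk Hl]]; apply HH in Hk; destruct Hk as [-> | ->]; rewrite lit_pos in Hl; auto.
    + intros [Hc | Hc].
      * exists (pair (pair (code N e) i) 0); rewrite lit_pos; split; auto; apply HH; auto.
      * exists (pair (pair (code N e) j) 0); rewrite lit_pos; split; auto; apply HH; auto.
  - exists r3, T3; split; auto; split; auto.
    exact (ext_trans (ext_trans He1 He2) He3).
Qed.

(** The source of infinite clauses: an existential statement is the disjunction of the variables of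
    all its instances. *)
Lemma clausal_ex N (P : (nat -> M) -> nset M -> Prop) :
  clausal (S N) P -> clausal N (fun e X => exists n, P (scons n e) X).
Proof.
  intros HP r T Hwf; destruct (HP r T Hwf) as [r1 [T1 [Hwf1 [He1 [i [Hi H1]]]]]].
  destruct (@comprehension2 M HM (fun c k => exists a, a < k + 1 /\
    k = pair (pair (pair a c) i) 0)) as [H [HH _]]; [definable|].
  destruct (@clausal_define N (fun e X => exists n, P (scons n e) X) r1 T1 H Hwf1)
    as [r2 [T2 [Hwf2 [He2 H2]]]].
  - intros c k Hk; apply HH in Hk; destruct Hk as [a [_ ->]]; exists (pair a c), i, 0; auto.
  - intros G HG X HX e; split.
    + intros [k [Hk Hl]]; apply HH in Hk; destruct Hk as [a [_ ->]].
      rewrite lit_pos in Hl; exists a; now apply (H1 G HG X HX (scons a e)).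
    + intros [a Ha]; apply (H1 G HG X HX (scons a e)) in Ha.
      exists (pair (pair (pair a (code N e)) i) 0); rewrite lit_pos; split; auto.
      apply HH; exists a; split; auto.
      apply lt_succ_le; do 2 (eapply le_trans; [|apply le_pair_l]); apply le_pair_l.
  - exists r2, T2; split; auto; split; auto; exact (ext_trans He1 He2).
Qed.

Lemma clausal_and N P Q : clausal N P -> clausal N Q -> clausal N (fun e X => P e X /\ Q e X).
Proof.
  intros HP HQ; apply (@clausal_iff N (fun e X => ~ (~ P e X \/ ~ Q e X))).
  - intros e X; split; [|tauto]. intros H; split; apply NNPP; tauto.
  - apply clausal_not, clausal_or; now apply clausal_not.
Qed.

Lemma clausal_lt N p (t u : term) : clausal N (fun e _ => eval (glue N e p) t < eval (glue N e p) u).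
Proof.
  destruct (term_values N p t) as [V HV]; destruct (term_values N p u) as [W HW].
  destruct (@Sigma_comprehension2 (fun c b a => a < b /\ V (pair c a) /\ W (pair c b)))
    as [A HA]; [definable|].
  destruct (HJ A) as [Z HZ]; apply (clausal_set (A := Z)).
  intros e; rewrite HZ; split.
  - intros [b Hb]; apply HA in Hb; destruct Hb as [a [H1 [H2 H3]]].
    apply HV in H2; apply HW in H3; congruence.
  - intros H; eexists; apply HA; eexists; split; [exact H|].
    split; [now apply HV | now apply HW].
Qed.

Lemma clausal_eq N p (t u : term) : clausal N (fun e _ => eval (glue N e p) t = eval (glue N e p) u).
Proof.
  destruct (term_values N p t) as [V HV]; destruct (term_values N p u) as [W HW].
  destruct (@comprehension2 M HM (fun c a => V (pair c a) /\ W (pair c a)))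
    as [A [HA _]]; [definable|].
  destruct (HJ A) as [Z HZ]; apply (clausal_set (A := Z)).
  intros e; rewrite HZ; split.
  - intros [b Hb]; apply HA in Hb; destruct Hb as [H2 H3].
    apply HV in H2; apply HW in H3; congruence.
  - intros H; eexists; apply HA; split; [apply HV; reflexivity | now apply HW].
Qed.

Lemma clausal_formula (f : formula) : arithmetical f ->
  forall N p (s : nat -> nset M), clausal N (fun e X => sat (glue N e p) (scons X s) f).
Proof.
  induction f as [t u | t u | t A | f IH | f IHf g IHg | f IHf g IHg | f IHf g IHg
    | t f IH | t f IH | f IH | f IH | |]; simpl; intros Hf N p s; try contradiction.
  - apply clausal_eq.
  - apply clausal_lt.
  - destruct (term_values N p t) as [V HV]; destruct A as [|A]; simpl.
    + exact (clausal_mem HV).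
    + destruct (@comprehension2 M HM (fun c y => V (pair c y) /\ s A y)) as [W [HW _]];
        [definable|].
      destruct (HJ W) as [Z HZ]; apply (clausal_set (A := Z)).
      intros e; rewrite HZ; split.
      * intros [y Hy]; apply HW in Hy; destruct Hy as [Hy HA]; apply HV in Hy; now subst y.
      * intros H; eexists; apply HW; split; [now apply HV | exact H].
  - apply clausal_not; auto.
  - apply clausal_and; [apply IHf | apply IHg]; tauto.
  - apply clausal_or; [apply IHf | apply IHg]; tauto.
  - apply (@clausal_iff N (fun e X => ~ sat (glue N e p) (scons X s) f \/
      sat (glue N e p) (scons X s) g)); [intros e X; tauto|].
    apply clausal_or; [apply clausal_not, IHf | apply IHg]; tauto.
  (* Bounded quantifiers become unbounded ones with a guard, whose term is shifted by [ren_term S]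
     past the bound variable. *)
  - apply (@clausal_iff N (fun e X => ~ exists n, n < eval (glue N e p) t /\
      ~ sat (scons n (glue N e p)) (scons X s) f)).
    { intros e X; split; [|firstorder].
      intros H n Hn; apply NNPP; intros H'; apply H; eauto. }
    apply clausal_not.
    refine (@clausal_ex N (fun e X => e O < eval (glue N (fun j => e (S j)) p) t /\
      ~ sat (glue (S N) e p) (scons X s) f) _).
    apply clausal_and; [|apply clausal_not, IH; auto].
    refine (clausal_iff _ (clausal_lt (S N) p (TVar O) (ren_term S t))).
    intros e _; simpl; now rewrite eval_ren.
  - refine (@clausal_ex N (fun e X => e O < eval (glue N (fun j => e (S j)) p) t /\
      sat (glue (S N) e p) (scons X s) f) _).
    apply clausal_and; [|apply IH; auto].
    refine (clausal_iff _ (clausal_lt (S N) p (TVar O) (ren_term S t))).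
    intros e _; simpl; now rewrite eval_ren.
  - apply (@clausal_iff N (fun e X => ~ exists n,
      ~ sat (scons n (glue N e p)) (scons X s) f)).
    { intros e X; split; [|firstorder].
      intros H n; apply NNPP; intros H'; apply H; eauto. }
    apply clausal_not.
    refine (@clausal_ex N (fun e X => ~ sat (glue (S N) e p) (scons X s) f) _).
    apply clausal_not, IH; auto.
  - refine (@clausal_ex N (fun e X => sat (glue (S N) e p) (scons X s) f) _); auto.
Qed.

Theorem normal_form (f : formula) (e : nat -> M) (s : nat -> nset M) : arithmetical f ->
  exists K : nset M, forall n,
    (exists X : nset M, sat (scons n e) (scons X s) f) <->
    (exists G : nset M, forall m, exists k, K (pair (pair m k) n) /\ lit G k).
Proof.
  intros Hf.
  (* The initial family is trivial, so that tag 0 can hold an arbitrary set. *)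
  destruct (@comprehension2 M HM (fun _ k => k = pair (pair 0 0) 0 \/ k = pair (pair 0 0) 1))
    as [T [HT _]]; [definable|].
  assert (Hwf : wf 1 T).
  { split; [rewrite <- (add_0_l 1); apply lt_self|].
    intros m k Hk; apply HT in Hk; apply tautology_tagged; auto.
    rewrite <- (add_0_l 1); apply lt_self. }
  destruct (clausal_formula Hf 1 e s Hwf) as [r [T' [_ [[_ [_ Hext]] [i [_ H]]]]]].
  (* Clause 0 asserts the instance at [n], where [pair n 0] is the code of the list with sole entry
     [n]; the other clauses are those of [T'] and do not depend on [n]. *)
  destruct (@comprehension3 M HM (fun m k n => (m = 0 /\ k = pair (pair (pair n 0) i) 0) \/
    (exists m', m' < m + 1 /\ (m = m' + 1 /\ T' (pair m' k))))) as [K [HK _]]; [definable|].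
  exists K; intros n; split.
  - intros [X HX].
    destruct (@comprehension2 M HM (fun x _ => X x)) as [G0 [HG0 _]]; [definable|].
    destruct (Hext G0) as [G [HG E]].
    { intros m; destruct (tautology_sat G0) as [k [Hk Hl]]; exists k; split; auto.
      now apply HT. }
    assert (HXG : forall x, X x <-> G (pair x 0)).
    { intros x; rewrite E, HG0; [tauto|]. rewrite <- (add_0_l 1); apply lt_self. }
    exists G; intros m; destruct (zero_or_succ m) as [-> | [m' ->]].
    + exists (pair (pair (pair n 0) i) 0); rewrite lit_pos; split; [apply HK; auto|].
      exact (proj2 (H G HG X HXG (fun _ => n)) HX).
    + destruct (HG m') as [k [Hk Hl]]; exists k; split; auto; apply HK; right.
      exists m'; split; [|auto]. pose proof (lt_self m'); pose proof (lt_self (m' + 1)); ord.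
  - intros [G HG].
    destruct (@comprehension M HM (fun x => G (pair x 0))) as [X HX]; [definable|].
    assert (HG' : models G T').
    { intros m; destruct (HG (m + 1)) as [k [Hk Hl]]; exists k; split; auto.
      apply HK in Hk; destruct Hk as [[E _] | [m' [_ [E Hk]]]].
      - now apply (succ_neq0 (RCA0_basic HM)) in E.
      - apply (succ_inj (RCA0_basic HM)) in E; now subst m'. }
    exists X; apply (H G HG' X HX (fun _ => n)).
    destruct (HG 0) as [k [Hk Hl]]; apply HK in Hk.
    destruct Hk as [[_ ->] | [m' [_ [E _]]]].
    + now rewrite lit_pos in Hl.
    + symmetry in E; now apply (succ_neq0 (RCA0_basic HM)) in E.
Qed.

End NormalForm.

(** * Strings *)

Ltac splits := repeat match goal with |- _ /\ _ => split end; auto.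

Section Strings.
Context {M : L2structure} {HM : RCA0 M}.
Hypothesis HJ : Sigma01_comprehension M.
Implicit Types (b c i j k l m n u v w x y z : M) (G X Y : nset M).

Lemma least_element (S : nset M) x : S x -> exists y, S y /\ forall z, z < y -> ~ S z.
Proof.
  intros Hx; apply NNPP; intros H.
  assert (K : forall n, forall y, y < n -> ~ S y).
  { induct; [definable | |].
    - intros y Hy; now apply lt_0_absurd in Hy.
    - intros n IH y Hy Sy; apply H; exists y; split; auto.
      intros z Hz; apply IH; ord. }
  exact (K (x + 1) x (lt_self x) Hx).
Qed.

(** The variable of a literal is at most its code, so a string of length above [k] decides the
    literal [k]. *)
Lemma lit_local (G G' : M -> Prop) k :
  (forall j, j < k + 1 -> (G j <-> G' j)) -> lit G k -> lit G' k.
Proof.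
  intros H [v [[-> Hv] | [-> Hv]]]; exists v; [left | right]; split; auto.
  - apply H; auto; apply lt_pair_l.
  - rewrite <- H; auto; apply lt_pair_l.
Qed.

Variable B : nset M.
Hypothesis HB : forall G l, exists c, forall j, j < l -> (B (pair c j) <-> G j).
Variable K : nset M.

Definition solution i G := forall m, exists k, K (pair (pair m k) i) /\ lit G k.

(* The string [pair c l] has length [l] and entries [B (pair c j)], [j < l]; a
   string has many codes.  [clause_true c m l i]: the first [l] entries of [c]
   make the [m]-th clause true. *)
Definition agree l c c' := forall j, j < l -> (B (pair c j) <-> B (pair c' j)).

Definition clause_true c m l i :=
  exists k, k < l /\ (K (pair (pair m k) i) /\ lit (fun j => B (pair c j)) k).

Lemma agree_sym l c c' : agree l c c' -> agree l c' c.
Proof. intros H j Hj; symmetry; auto. Qed.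

Lemma agree_trans l l' c c' c'' : l <= l' -> agree l c c' -> agree l' c' c'' -> agree l c c''.
Proof. intros Hl H H' j Hj; rewrite (H j Hj); apply H'; ord. Qed.

Lemma agree_le l l' c c' : l <= l' -> agree l' c c' -> agree l c c'.
Proof. intros Hl H j Hj; apply H; ord. Qed.

Lemma clause_true_agree c c' m l i : agree l c c' -> clause_true c m l i -> clause_true c' m l i.
Proof.
  intros H [k [Hk [HK Hl]]]; exists k; repeat split; auto.
  revert Hl; apply lit_local; intros j Hj; apply H; ord.
Qed.

Lemma clause_true_solution c m l i G : (forall j, j < l -> (B (pair c j) <-> G j)) ->
  (clause_true c m l i <-> exists k, k < l /\ (K (pair (pair m k) i) /\ lit G k)).
Proof.
  intros H; split; intros [k [Hk [HK Hl]]]; exists k; repeat split; auto;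
    revert Hl; apply lit_local; intros j Hj; [|symmetry]; apply H; ord.
Qed.

Lemma clause_true_set : exists C : nset M, forall c m l i,
  C (pair (pair (pair c m) l) i) <-> clause_true c m l i.
Proof.
  destruct (@comprehension2 M HM (fun c k => exists v, v < k + 1 /\
    ((k = pair v 0 /\ B (pair c v)) \/ (k = pair v 1 /\ ~ B (pair c v))))) as [L [HL _]];
    [definable|].
  destruct (@comprehension4 M HM (fun c m l i => exists k, k < l /\
    (K (pair (pair m k) i) /\ L (pair c k)))) as [C [HC _]]; [definable|].
  exists C; intros c m l i; rewrite HC; unfold clause_true.
  split; intros [k [Hk [HK H]]]; exists k; repeat split; auto.
  - apply HL in H; destruct H as [v [_ H]]; exists v; auto.
  - apply HL; destruct H as [v H]; exists v; split; auto.
    destruct H as [[-> _] | [-> _]]; apply lt_pair_l.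
Qed.

(** A bounding argument: Sigma^0_1 induction on [b] collects the true literals of the first [b]
    clauses below a common length. *)
Lemma solution_bound i G b : solution i G -> exists l, b <= l /\
  forall m, m < b -> exists k, k < l /\ (K (pair (pair m k) i) /\ lit G k).
Proof.
  intros HG.
  destruct (@comprehension M HM (fun k => exists v, v < k + 1 /\
    ((k = pair v 0 /\ G v) \/ (k = pair v 1 /\ ~ G v)))) as [L HL]; [definable|].
  assert (HL' : forall k, L k <-> lit G k).
  { intros k; rewrite HL; split; [intros [v [_ H]]; exists v; auto|].
    intros [v H]; exists v; split; auto; destruct H as [[-> _] | [-> _]]; apply lt_pair_l. }
  assert (H : forall b, exists l, b <= l /\
    forall m, m < b -> exists k, k < l /\ (K (pair (pair m k) i) /\ L k)).
  { clear b; apply Sigma_induction; [definable | |].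
    - exists 0; split; auto; intros m Hm; now apply lt_0_absurd in Hm.
    - intros b [l [Hb H]]; destruct (HG b) as [k [HK Hk]].
      destruct (upper_bound (l + 1) (k + 1)) as [l' [H1 H2]]; exists l'; split.
      + apply le_succ_lt; ord.
      + intros m Hm; apply lt_succ_le in Hm; destruct Hm as [Hm | ->].
        * destruct (H m Hm) as [k' [Hk' H']]; exists k'; split; auto; ord.
        * exists k; rewrite HL'; split; auto; ord. }
  destruct (H b) as [l [Hb Hl]]; exists l; split; auto.
  intros m Hm; destruct (Hl m Hm) as [k Hk]; exists k; now rewrite <- HL'.
Qed.

Lemma string_set : exists X, forall p i, X (pair p i) <-> exists c l, p = pair c l.
Proof.
  destruct (@comprehension2 M HM (fun p _ => exists c, c < p + 1 /\ exists l, l < p + 1 /\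
    p = pair c l)) as [X [HX _]]; [definable|].
  exists X; intros p i; rewrite HX; split.
  - intros [c [_ [l [_ H]]]]; eauto.
  - intros [c [l ->]]; exists c; split; [apply lt_pair_l|]; exists l; split; [apply lt_pair_r | auto].
Qed.

Definition progress i x y := exists c l c' l', x = pair c l /\ y = pair c' l' /\
  l < l' /\ agree l c c' /\ forall m, m < l + 1 -> clause_true c' m l' i.

Lemma progress_trans i x y z : progress i x y -> progress i y z -> progress i x z.
Proof.
  intros [c [l [c' [l' [-> [-> [Hl [Ha _]]]]]]]] [d' [u' [c'' [l'' [E [-> [Hl' [Ha' Hc]]]]]]]].
  pair_inv; exists c, l, c'', l''; repeat split; auto.
  - ord.
  - intros Hj; apply (@agree_trans l u' c d' c''); auto.
  - intros Hj; apply (@agree_trans l u' c d' c''); auto.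
  - intros m Hm; apply Hc; ord.
Qed.

Lemma progress_set : exists R : nset M, forall x y i, R (pair (pair x y) i) <-> progress i x y.
Proof.
  destruct clause_true_set as [C HC].
  destruct (@comprehension3 M HM (fun x y i =>
    exists c, c < x + 1 /\ exists l, l < x + 1 /\ exists c', c' < y + 1 /\ exists l', l' < y + 1 /\
      (x = pair c l /\ y = pair c' l' /\ l < l' /\
       (forall j, j < l -> (B (pair c j) <-> B (pair c' j))) /\
       forall m, m < l + 1 -> C (pair (pair (pair c' m) l') i)))) as [R [HR _]]; [definable|].
  exists R; intros x y i; rewrite HR; split.
  - intros [c [_ [l [_ [c' [_ [l' [_ [-> [-> [Hl [Ha Hc]]]]]]]]]]]].
    exists c, l, c', l'; repeat split; auto; try apply Ha; auto.
    intros m Hm; apply HC; auto.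
  - intros [c [l [c' [l' [-> [-> [Hl [Ha Hc]]]]]]]].
    exists c; split; [apply lt_pair_l|]; exists l; split; [apply lt_pair_r|].
    exists c'; split; [apply lt_pair_l|]; exists l'; split; [apply lt_pair_r|].
    repeat split; auto; try apply Ha; auto. intros m Hm; apply HC; auto.
Qed.

(** Without a maximal point, [Y] contains an infinite increasing chain, and the union of its strings
    is a solution. *)
Lemma progress_solution i Y x0 :
  Y x0 -> (forall x, Y x -> exists y, Y y /\ progress i x y) -> exists G, solution i G.
Proof.
  intros Hx0 HY; destruct progress_set as [R HR].
  (* The least successor within [Y]; outside [Y] the identity, as [iteration] requires a total
     function. *)
  destruct (@comprehension2 M HM (fun x y => (Y x /\ (Y y /\ R (pair (pair x y) i)) /\
    forall z, z < y -> ~ (Y z /\ R (pair (pair x z) i))) \/ (~ Y x /\ y = x))) as [F [HF _]];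
    [definable|].
  assert (HFex : forall x, Y x -> exists y, F (pair x y)).
  { intros x Hx.
    destruct (@comprehension M HM (fun y => Y y /\ R (pair (pair x y) i))) as [S HS]; [definable|].
    destruct (HY x Hx) as [y0 [Hy0 Hxy0]].
    destruct (@least_element S y0) as [y [Hy Hy']]; [apply HS; split; auto; now apply HR|].
    exists y; apply HF; left; split; auto; split; [now apply HS|].
    intros z Hz; rewrite <- HS; auto. }
  destruct (@iteration M HM F x0) as [g [[[Hgp Hgf] Hgt] [Hg0 HgS]]].
  - intros x; destruct (classic (Y x)) as [Hx | Hx]; [auto|exists x; apply HF; auto].
  - intros x y z Hy Hz; apply HF in Hy, Hz.
    destruct Hy as [[Hx [Hy Hy']] | [Hx ->]], Hz as [[Hx' [Hz Hz']] | [Hx' ->]];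
      try contradiction; auto.
    destruct (lt_or_le y z) as [H | [H | H]]; auto.
    + now apply Hz' in H.
    + now apply Hy' in H.
  - assert (Hstep : forall n x y, Y x -> g (pair n x) -> g (pair (n + 1) y) ->
      Y y /\ progress i x y).
    { intros n x y Hx Hgx Hgy.
      destruct (HFex x Hx) as [y' Hy']; pose proof (HgS n x y' Hgx Hy') as Hgy'.
      assert (y' = y) by exact (Hgf _ _ _ Hgy' Hgy); subst y'.
      apply HF in Hy'; destruct Hy' as [[_ [[H1 H2] _]] | [H _]]; [|contradiction].
      split; auto; now apply HR. }
    assert (HgY : forall n, exists x, g (pair n x) /\ Y x).
    { apply Sigma_induction; [definable | eauto |].
      intros n [x [Hx HYx]]; destruct (Hgt (n + 1)) as [y Hy]; [exact I|].
      exists y; split; auto; now apply (Hstep n x y). }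
    assert (HgY' : forall n x, g (pair n x) -> Y x).
    { intros n x Hx; destruct (HgY n) as [x' [Hx' HYx]].
      now rewrite (Hgf _ _ _ Hx Hx'). }
    assert (Hchain : forall n x d, g (pair n x) ->
      exists y, g (pair (n + d) y) /\ (y = x \/ R (pair (pair x y) i))).
    { intros n x d Hx; revert d; apply Sigma_induction; [definable | |].
      - exists x; rewrite add_comm, add_0_l; auto.
      - intros d [y [Hy Hxy]]; destruct (Hgt (n + (d + 1))) as [z Hz]; [exact I|].
        exists z; split; auto; right; apply HR.
        rewrite add_assoc in Hz.
        destruct (Hstep _ _ _ (HgY' _ _ Hy) Hy Hz) as [_ Hyz].
        destruct Hxy as [-> | Hxy]; auto. apply HR in Hxy; exact (progress_trans Hxy Hyz). }
    assert (Hlen : forall n, exists x, g (pair n x) /\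
      exists c, c < x + 1 /\ exists l, l < x + 1 /\ (x = pair c l /\ n <= l)).
    { apply Sigma_induction; [definable | |].
      - exists x0; split; auto.
        destruct (HY x0 Hx0) as [y [_ [c [l [_ [_ [-> _]]]]]]].
        exists c; split; [apply lt_pair_l|]; exists l; split; [apply lt_pair_r|].
        split; auto; apply le_0.
      - intros n [x [Hx [c [_ [l [_ [-> Hl]]]]]]].
        destruct (Hgt (n + 1)) as [y Hy]; [exact I|]; exists y; split; auto.
        destruct (Hstep _ _ _ (HgY' _ _ Hx) Hx Hy) as [_ [c1 [l1 [c' [l' [E [-> [Hl' _]]]]]]]].
        pair_inv; exists c'; split; [apply lt_pair_l|]; exists l'; split; [apply lt_pair_r|].
        split; auto; apply le_succ_lt; ord. }
    (* The string at stage [j + 1] has length at least [j + 1], so its entry [j] exists and is kept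
       by all later strings. *)
    destruct (@comprehension2 M HM (fun j x => g (pair (j + 1) x) /\
      exists c, c < x + 1 /\ exists l, l < x + 1 /\ (x = pair c l /\ B (pair c j))))
      as [A [HA _]]; [definable|].
    destruct (HJ A) as [G HG].
    assert (HG' : forall j c l, g (pair (j + 1) (pair c l)) -> (G j <-> B (pair c j))).
    { intros j c l Hg; rewrite HG; split.
      - intros [x Hx]; apply HA in Hx; destruct Hx as [Hx [c' [_ [l' [_ [-> Hb]]]]]].
        pose proof (Hgf _ _ _ Hg Hx); pair_inv; auto.
      - intros Hb; exists (pair c l); apply HA; split; auto.
        exists c; split; [apply lt_pair_l|]; exists l; split; [apply lt_pair_r | auto]. }
    assert (Hmono : forall n n' c l c' l', n <= n' -> g (pair n (pair c l)) ->
      g (pair n' (pair c' l')) -> agree l c c').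
    { intros n n' c l c' l' Hn Hx Hx'; apply le_iff in Hn; destruct Hn as [d ->].
      destruct (Hchain n _ d Hx) as [y [Hy Hxy]].
      rewrite (Hgf _ _ _ Hy Hx') in Hxy; destruct Hxy as [E | Hxy].
      - pair_inv; intros j Hj; tauto.
      - apply HR in Hxy; destruct Hxy as [c1 [l1 [c2 [l2 [E1 [E2 [_ [Ha _]]]]]]]].
        pair_inv; auto. }
    assert (Hlim : forall n c l, g (pair n (pair c l)) -> forall j, j < l -> (B (pair c j) <-> G j)).
    { intros n c l Hx j Hj.
      destruct (Hlen (j + 1)) as [x' [Hx' [c' [_ [l' [_ [-> Hl']]]]]]].
      rewrite (HG' _ _ _ Hx').
      destruct (lt_or_le n (j + 1)) as [Hn | Hn].
      - apply (Hmono n (j + 1) c l c' l'); auto.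
      - symmetry; apply (Hmono (j + 1) n c' l' c l); auto; ord. }
    (* The string at stage [m] has length at least [m], so its successor makes the clause [m]
       true. *)
    exists G; intros m.
    destruct (Hlen m) as [x [Hx [c [_ [l [_ [-> Hl]]]]]]].
    destruct (Hgt (m + 1)) as [y Hy]; [exact I|].
    destruct (Hstep _ _ _ (HgY' _ _ Hx) Hx Hy) as [_ [c1 [l1 [c' [l' [E [-> [_ [_ Hc]]]]]]]]].
    pair_inv; destruct (proj1 (clause_true_solution _ _ (Hlim _ _ _ Hy)) (Hc m (proj2 (lt_succ_le _ _) Hl)))
      as [k [_ Hk]]; eauto.
Qed.

Lemma scattered_no_solution : scattered_index_set_exists M ->
  exists Z : nset M, forall i, Z i <-> ~ exists G, solution i G.
Proof.
  intros HS; destruct string_set as [X HX]; destruct progress_set as [R HR].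
  destruct (@noetherian_index_set M HM X R HS) as [Z HZ].
  - intros i x y z; rewrite !HR; apply progress_trans.
  - intros i x; rewrite HR; intros [c [l [c' [l' [-> [E [Hl _]]]]]]]; pair_inv.
    now apply lt_irrefl in Hl.
  - exists Z; intros i; rewrite HZ; split.
    + intros H [G HG].
      (* The initial segments of a solution have no maximal element: a long enough one makes the
         first [l + 1] clauses true. *)
      destruct (@comprehension M HM (fun p => exists c, c < p + 1 /\ exists l, l < p + 1 /\
        (p = pair c l /\ forall j, j < l -> (B (pair c j) <-> G j)))) as [Y HY]; [definable|].
      assert (HY' : forall c l, (forall j, j < l -> (B (pair c j) <-> G j)) -> Y (pair c l)).
      { intros c l Hc; apply HY; exists c; split; [apply lt_pair_l|].
        exists l; split; [apply lt_pair_r | auto]. }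
      destruct (H Y) as [x [Hx Hmax]].
      * intros x Hx; apply HX; apply HY in Hx; destruct Hx as [c [_ [l [_ [-> _]]]]]; eauto.
      * exists (pair 0 0); apply HY'; intros j Hj; now apply lt_0_absurd in Hj.
      * apply HY in Hx; destruct Hx as [c [_ [l [_ [-> Hc]]]]].
        destruct (solution_bound (l + 1) HG) as [l' [Hl' Hsol]].
        destruct (HB G l') as [c' Hc'].
        apply (Hmax (pair c' l')); auto; apply HR.
        exists c, l, c', l'; repeat split; auto.
        -- now apply le_succ_lt.
        -- intros Hb; apply Hc', Hc; auto; ord.
        -- intros Hb; apply Hc, Hc'; auto; ord.
        -- intros m Hm; apply (clause_true_solution _ _ Hc'); auto.
    + intros H Y HYX [x0 Hx0]; apply NNPP; intros Hmax; apply H.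
      apply (@progress_solution i Y x0); auto.
      intros x Hx; apply NNPP; intros Hx'; apply Hmax; exists x; split; auto.
      intros y Hy; rewrite HR; intros Hxy; apply Hx'; eauto.
Qed.

(* Two strings are [b]-close when a common initial segment of length at least
   [b] makes the first [b] clauses true: the Cauchy sequences without a limit
   are those which converge to a solution. *)
Definition close i x y b := exists c l c' l' h, x = pair c l /\ y = pair c' l' /\
  h <= l /\ h <= l' /\ b <= h /\ agree h c c' /\ forall m, m < b -> clause_true c m h i.

Lemma close_set : exists D : nset M, forall x y b i,
  D (pair (pair (pair x y) b) i) <-> close i x y b.
Proof.
  destruct clause_true_set as [C HC].
  destruct (@comprehension4 M HM (fun x y b i =>
    exists c, c < x + 1 /\ exists l, l < x + 1 /\ exists c', c' < y + 1 /\ exists l', l' < y + 1 /\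
    exists h, h < l + 1 /\
      (x = pair c l /\ y = pair c' l' /\ h < l' + 1 /\ b < h + 1 /\
       (forall j, j < h -> (B (pair c j) <-> B (pair c' j))) /\
       forall m, m < b -> C (pair (pair (pair c m) h) i)))) as [D [HD _]]; [definable|].
  exists D; intros x y b i; rewrite HD; split.
  - intros [c [_ [l [_ [c' [_ [l' [_ [h [Hh [-> [-> [Hh' [Hb [Ha Hc]]]]]]]]]]]]]]].
    rewrite lt_succ_le in Hh, Hh', Hb.
    exists c, l, c', l', h; splits; intros m Hm; apply HC; auto.
  - intros [c [l [c' [l' [h [-> [-> [Hh [Hh' [Hb [Ha Hc]]]]]]]]]]].
    exists c; split; [apply lt_pair_l|]; exists l; split; [apply lt_pair_r|].
    exists c'; split; [apply lt_pair_l|]; exists l'; split; [apply lt_pair_r|].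
    exists h; rewrite !lt_succ_le; splits; intros m Hm; apply HC; auto.
Qed.

Lemma close_closeness i (X : M -> Prop) :
  (forall x, X x -> exists c l, x = pair c l) -> closeness X (close i).
Proof.
  intros HX; split.
  - intros x y Hx Hy; apply HX in Hx, Hy; destruct Hx as [c [l ->]], Hy as [c' [l' ->]].
    exists c, l, c', l', 0; do 2 (split; [reflexivity|]); do 2 (split; [apply le_0|]).
    split; [auto|]; split; intros j Hj; now apply lt_0_absurd in Hj.
  - intros x y u v Huv [c [l [c' [l' [h [-> [-> [Hh [Hh' [Hb [Ha Hc]]]]]]]]]]].
    exists c, l, c', l', h; splits; [ord|]; intros m Hm; apply Hc; ord.
  - intros x y Hx _; destruct (HX x Hx) as [c [l ->]]; exists (l + 1).
    intros [c1 [l1 [c' [l' [h [E [-> [Hh [Hh' [Hb _]]]]]]]]]]; pair_inv; ord.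
  - intros x y b [c [l [c' [l' [h [-> [-> [Hh [Hh' [Hb [Ha Hc]]]]]]]]]]].
    exists c', l', c, l, h; splits; [now apply agree_sym|].
    intros m Hm; apply (clause_true_agree Ha); auto.
  - intros x y z b [c [l [c' [l' [h [-> [-> [Hh [Hh' [Hb [Ha Hc]]]]]]]]]]]
      [d' [u' [c'' [l'' [h' [E [-> [Hu [Hu' [Hb' [Ha' Hc']]]]]]]]]]]; pair_inv.
    (* The shorter of the two common initial segments serves for [x] and [z]. *)
    destruct (lt_or_le h' h) as [H | H].
    + exists c, l, c'', l'', h'; splits; [ord | |].
      * apply (@agree_trans h' h' c d' c''); auto.
        apply (@agree_le h' h); auto.
      * intros m Hm; apply (@clause_true_agree d' c); auto.
        apply agree_sym, (@agree_le h' h); auto.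
    + exists c, l, c'', l'', h; splits; [ord|].
      apply (@agree_trans h h' c d' c''); auto.
Qed.

Lemma solution_not_complete i G (X : M -> Prop) :
  (forall x, X x <-> exists c l, x = pair c l) -> solution i G -> ~ close_complete X (close i).
Proof.
  intros HX HG H.
  destruct (@comprehension2 M HM (fun l c => forall j, j < l -> (B (pair c j) <-> G j)))
    as [S [HS _]]; [definable|].
  (* The initial segments of [G], each with its least code, since a string has many codes. *)
  destruct (@comprehension2 M HM (fun n p => exists c, c < p + 1 /\ (p = pair c n /\
    S (pair n c) /\ forall c', c' < c -> ~ S (pair n c')))) as [a [Ha Ha2]]; [definable|].
  assert (Ha' : forall n p, a (pair n p) ->
    exists c, p = pair c n /\ forall j, j < n -> (B (pair c j) <-> G j)).
  { intros n p Hp; apply Ha in Hp; destruct Hp as [c [_ [-> [Hc _]]]]; exists c; split; auto.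
    now apply HS. }
  assert (Hfun : is_function (all_num (M := M)) X a).
  { split; [split|].
    - intros q Hq; destruct (Ha2 q Hq) as [n [p ->]]; exists n, p; repeat split.
      apply HX; destruct (Ha' _ _ Hq) as [c [-> _]]; eauto.
    - intros n p p' Hp Hp'; apply Ha in Hp, Hp'.
      destruct Hp as [c [_ [-> [Hc Hmin]]]], Hp' as [c' [_ [-> [Hc' Hmin']]]].
      f_equal; destruct (lt_or_le c c') as [L | [L | L]]; auto.
      + now apply Hmin' in L.
      + now apply Hmin in L.
    - intros n _; destruct (HB G n) as [c0 Hc0].
      destruct (@comprehension M HM (fun c => S (pair n c))) as [Sn HSn]; [definable|].
      destruct (@least_element Sn c0) as [c [Hc Hmin]]; [now apply HSn, HS|].
      exists (pair c n); apply Ha; exists c; split; [apply lt_pair_l|].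
      split; auto; split; [now apply HSn|]. intros c' Hc'; rewrite <- HSn; auto. }
  destruct (H a Hfun) as [x [Hx Hconv]].
  - intros b; destruct (solution_bound b HG) as [h [Hb Hh]]; exists h.
    intros m n x y Hm Hn Hx Hy; right.
    destruct (Ha' _ _ Hx) as [c [-> Hc]]; destruct (Ha' _ _ Hy) as [c' [-> Hc']].
    exists c, m, c', n, h; splits.
    + intros j Hj; rewrite Hc, Hc'; [tauto | ord | ord].
    + intros k Hk; apply (@clause_true_solution c k h i G); auto.
      intros j Hj; apply Hc; ord.
  - apply HX in Hx; destruct Hx as [c [l ->]].
    (* Closeness at level [l + 1] needs two strings longer than [l], so a string of length [l] is no
       limit of ever longer ones. *)
    destruct (Hconv (l + 1)) as [n0 Hn0].
    destruct (upper_bound n0 (l + 1)) as [n [H1 H2]].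
    destruct Hfun as [_ Htot]; destruct (Htot n) as [y Hy]; [exact I|].
    destruct (Ha' _ _ Hy) as [c' [-> _]].
    destruct (Hn0 n _ H1 Hy) as [E | [c1 [l1 [c2 [l2 [h [E1 [E2 [_ [Hh [Hb _]]]]]]]]]]].
    + pair_inv; ord.
    + pair_inv; ord.
Qed.

Lemma not_complete_solution i (X : M -> Prop) :
  (forall x, X x <-> exists c l, x = pair c l) -> ~ close_complete X (close i) ->
  exists G, solution i G.
Proof.
  intros HX H; apply NNPP; intros HN; apply H; clear H.
  intros a [[Ha Hafun] Hatot] Hcauchy; apply NNPP; intros Hconv; apply HN; clear HN.
  assert (HaX : forall n x, a (pair n x) -> exists c l, x = pair c l).
  { intros n x Hx; destruct (Ha _ Hx) as [n' [x' [E [_ Hx']]]]; pair_inv; now apply HX. }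
  (* [G] is the limit inferior of the strings. [Z1] contains [pair j n] if entry [j] is false at
     some stage from [n] on; the quantifier over [n] takes a second use of [HJ]. *)
  destruct (@comprehension3 M HM (fun j n q => exists m, m < q + 1 /\ exists x, x < q + 1 /\
    (q = pair m x /\ n < m + 1 /\ a (pair m x) /\
      exists c, c < x + 1 /\ exists l, l < x + 1 /\ (x = pair c l /\ ~ B (pair c j)))))
    as [A1 [HA1 _]]; [definable|].
  destruct (HJ A1) as [Z1 HZ1].
  destruct (@comprehension2 M HM (fun j n => ~ Z1 (pair j n))) as [A2 [HA2 _]]; [definable|].
  destruct (HJ A2) as [G HG].
  assert (HG' : forall j, G j <-> exists n, forall m c l, n <= m -> a (pair m (pair c l)) ->
    B (pair c j)).
  { intros j; rewrite HG; split; intros [n Hn]; exists n.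
    - intros m c l Hm Hmc; apply HA2 in Hn; rewrite HZ1 in Hn; apply NNPP; intros Hb.
      apply Hn; exists (pair m (pair c l)); apply HA1.
      exists m; split; [apply lt_pair_l|]; eexists; split; [apply lt_pair_r|].
      repeat split; auto; [now apply lt_succ_le|].
      exists c; split; [apply lt_pair_l|]; exists l; split; [apply lt_pair_r | auto].
    - apply HA2; rewrite HZ1; intros [q Hq]; apply HA1 in Hq.
      destruct Hq as [m [_ [x [_ [_ [Hm [Hx [c [_ [l [_ [-> Hb]]]]]]]]]]]].
      rewrite lt_succ_le in Hm; apply Hb, (Hn m c l); auto. }
  exists G; intros m; destruct (Hcauchy (m + 1)) as [n0 Hn0].
  destruct (Hatot n0) as [x Hx]; [exact I|]; destruct (HaX _ _ Hx) as [c [l ->]].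
  (* Otherwise the term at [n0] would be the limit. A later term that differs from it has to be
     close to it at level [m + 1]. *)
  assert (H1 : exists n1 y, n0 <= n1 /\ a (pair n1 y) /\ y <> pair c l).
  { apply NNPP; intros H1; apply Hconv; exists (pair c l); split; [apply HX; eauto|].
    intros b; exists n0; intros n y Hn Hy; left; apply NNPP; intros Hne; apply H1; eauto. }
  destruct H1 as [n1 [y1 [Hn1 [Hy1 Hne]]]].
  destruct clause_true_set as [C HC].
  (* The segment shared with [pair c l] may vary with the later term, but its length is always in
     [S]; hence all later terms share the segment of the least length in [S]. *)
  destruct (@comprehension M HM (fun h => h < l + 1 /\ m + 1 < h + 1 /\
    forall k, k < m + 1 -> C (pair (pair (pair c k) h) i))) as [S HS]; [definable|].
  assert (HcloseS : forall y, close i (pair c l) y (m + 1) ->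
    exists h c' l', S h /\ y = pair c' l' /\ agree h c c').
  { intros y [c1 [l1 [c' [l' [h [E [-> [Hh [_ [Hb [Hag Hcl]]]]]]]]]]]; pair_inv.
    exists h, c', l'; splits; apply HS; rewrite !lt_succ_le.
    splits; intros k Hk; apply HC, Hcl; auto; now apply lt_succ_le. }
  assert (HS0 : exists h, S h).
  { destruct (Hn0 n0 n1 (pair c l) y1) as [E | E]; auto; [congruence|].
    destruct (HcloseS _ E) as [h [_ [_ [Hh _]]]]; eauto. }
  destruct HS0 as [h1 Hh1]; destruct (least_element Hh1) as [h [Hh Hmin]].
  assert (Hag : forall n c' l', n0 <= n -> a (pair n (pair c' l')) -> agree h c c').
  { intros n c' l' Hn Hy; destruct (Hn0 n0 n (pair c l) (pair c' l')) as [E | E]; auto.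
    - pair_inv; intros j _; tauto.
    - destruct (HcloseS _ E) as [h' [c1 [l1 [Hh' [E1 Hag]]]]]; pair_inv.
      apply (@agree_le h h'); auto; apply not_lt; intros L; exact (Hmin _ L Hh'). }
  assert (HcG : forall j, j < h -> (B (pair c j) <-> G j)).
  { intros j Hj; rewrite HG'; split.
    - intros Hb; exists n0; intros n c' l' Hn Hy; apply (Hag n c' l' Hn Hy j Hj); auto.
    - intros [n Hn]; destruct (upper_bound n n0) as [n' [H1 H2]].
      destruct (Hatot n') as [y Hy]; [exact I|]; destruct (HaX _ _ Hy) as [c' [l' ->]].
      apply (Hag n' c' l' H2 Hy j Hj); exact (Hn n' c' l' H1 Hy). }
  apply HS in Hh; destruct Hh as [_ [_ Hcl]].
  specialize (Hcl m (lt_self m)); rewrite HC in Hcl.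
  destruct (proj1 (clause_true_solution _ _ HcG) Hcl) as [k [_ Hk]]; eauto.
Qed.

Lemma complete_no_solution : complete_index_set_exists M ->
  exists Z : nset M, forall i, Z i <-> ~ exists G, solution i G.
Proof.
  intros HC; destruct string_set as [X HX]; destruct close_set as [D HD].
  assert (HX' : forall i x, section X i x <-> exists c l, x = pair c l) by (intros i x; apply HX).
  destruct (@close_complete_index_set M HM X D HC) as [Z HZ].
  - intros i; pose proof (@close_closeness i (section X i) (fun x => proj1 (HX' i x))) as H.
    destruct H as [H0 Hle Hbound Hsym Htrans]; split.
    + intros x y Hx Hy; apply HD; auto.
    + intros x y u v Huv; rewrite !HD; eauto.
    + intros x y Hx Hy; destruct (Hbound x y Hx Hy) as [b Hb]; exists b; now rewrite HD.
    + intros x y b; rewrite !HD; auto.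
    + intros x y z b; rewrite !HD; eauto.
  - exists Z; intros i; rewrite HZ.
    assert (E : close_complete (section X i) (fun x y b => D (pair (pair (pair x y) b) i)) <->
      close_complete (section X i) (close i)).
    { split; intros H a Ha Hc.
      - destruct (H a Ha) as [x [Hx Hconv]].
        + intros b; destruct (Hc b) as [n0 Hn0]; exists n0; intros; rewrite HD; eauto.
        + exists x; split; auto; intros b; destruct (Hconv b) as [n0 Hn0]; exists n0.
          intros n y Hn Hy; rewrite <- HD; eauto.
      - destruct (H a Ha) as [x [Hx Hconv]].
        + intros b; destruct (Hc b) as [n0 Hn0]; exists n0; intros m n x y; rewrite <- HD; eauto.
        + exists x; split; auto; intros b; destruct (Hconv b) as [n0 Hn0]; exists n0.
          intros n y Hn Hy; rewrite HD; eauto. }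
    rewrite E; split.
    + intros H [G HG]; exact (solution_not_complete (HX' i) HG H).
    + intros H; apply NNPP; intros H'; apply H; exact (not_complete_solution (HX' i) H').
Qed.

End Strings.

(** * The equivalences *)

Section FromComprehension.
Context {M : L2structure} {HM : RCA0 M}.
Hypothesis HP : Pi11_comprehension M.

Lemma Pi11_set (P : M -> nset M -> Prop) :
  rep arithmetical 1 (fun e Y => P (e O) Y) ->
  exists Z : nset M, forall n, Z n <-> forall Y, P n Y.
Proof.
  intros [f [p [s [Cf H]]]].
  destruct (HP (f := FSetAll f) p s) as [Z HZ]; [exists f; auto|].
  exists Z; intros n; rewrite HZ; simpl; split; intros HY Y; now apply (H (fun _ => n) Y).
Qed.

Lemma Pi11_scattered : scattered_index_set_exists M.
Proof.
  intros X U k _; unfold scattered, isolated_in, section; apply Pi11_set; definable.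
Qed.

Lemma rep_all_rat N (Q : (nat -> M) -> rat M -> nset M -> Prop) :
  rep arithmetical (S (S (S N)))
    (fun e Y => Q (fun i => e (S (S (S i)))) (Rat (e 2%nat) (e 1%nat) (e O)) Y) ->
  rep arithmetical N (fun e Y => forall q, Q e q Y).
Proof.
  intros H; apply (@rep_iff _ _ N (fun e Y => forall a b c, Q e (Rat a b c) Y)).
  - intros e Y; split; [intros H' [a b c]; auto | auto].
  - do 3 apply rep_all; exact H.
Qed.

Lemma rep_rat_eq N (x y z x' y' z' : (nat -> M) -> M) :
  rep arithmetical N (fun e _ => x e = x' e /\ y e = y' e /\ z e = z' e) ->
  rep arithmetical N (fun e _ => Rat (x e) (y e) (z e) = Rat (x' e) (y' e) (z' e)).
Proof.
  apply rep_iff; intros e _; split; [intros [-> [-> ->]]; auto|].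
  intros E; injection E; auto.
Qed.

(** [is_pow2] begins with an existential set quantifier, so Pi^1_1 comprehension yields the
    complement. *)
Lemma pow2_set : exists Z : nset M, forall k m, is_pow2 k m <-> ~ Z (pair k m).
Proof.
  destruct (@Pi11_set (fun n F => ~ exists k m, n = pair k m /\
    is_function (all_num (M := M)) (all_num (M := M)) F /\
    F (pair 0 1) /\ (forall j v, F (pair j v) -> F (pair (j + 1) (v + v))) /\ F (pair k m)))
    as [Z HZ].
  - unfold is_function, is_partial_function, prod, all_num; definable.
  - exists Z; intros k m; rewrite HZ; unfold is_pow2; split.
    + intros [F HF] H; apply (H F); exists k, m; auto.
    + intros H; apply NNPP; intros H'; apply H; intros F [k' [m' [E HF]]]; pair_inv.
      apply H'; exists F; auto.
Qed.

Lemma rep_pow2 N (x y : (nat -> M) -> M) : trep N x -> trep N y ->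
  rep arithmetical N (fun e _ => is_pow2 (x e) (y e)).
Proof.
  intros Hx Hy; destruct pow2_set as [Z HZ].
  apply (@rep_iff _ _ N (fun e _ => ~ Z (pair (x e) (y e)))).
  - intros e _; now rewrite HZ.
  - apply rep_not, rep_mem, trep_pair; auto; exact arithmetical_class.
Qed.

Ltac definable_rat :=
  cbv beta iota delta [rpos rneg rden]; definable;
  lazymatch goal with
  | |- rep _ ?k (fun e Y => forall q : rat _, @?R e q Y) =>
      apply (@rep_all_rat k R); definable_rat
  | |- rep _ _ (fun e Y => Rat _ _ _ = Rat _ _ _) => apply rep_rat_eq; definable_rat
  | |- rep _ _ (fun e Y => is_pow2 _ _) => apply rep_pow2; solve_trep
  end.

Lemma Pi11_complete : complete_index_set_exists M.
Proof.
  intros X d _.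
  unfold complete, is_function, is_partial_function, prod, all_num, cauchy, converges_to,
    real_lt, real_le, real_of_rat, dist, is_inv_pow2, rat_lt, rat_le, rat_add, rat_code,
    section, rat0.
  apply Pi11_set.
  definable_rat.
Qed.

End FromComprehension.

Section Main.
Context {M : L2structure} {HM : RCA0 M}.

(** A Pi^1_1 statement holds exactly if the clauses for its negated matrix have no solution. *)
Lemma Pi11_comprehension_of_solutions : Sigma01_comprehension M ->
  (forall K : nset M, exists Z : nset M, forall i, Z i <-> ~ exists G, solution K i G) ->
  Pi11_comprehension M.
Proof.
  intros HJ HK f e s [g [Hg ->]].
  destruct (@normal_form M HM HJ (FNot g) e s Hg) as [K HKg].
  destruct (HK K) as [Z HZ]; exists Z; intros i; rewrite HZ; unfold solution.
  rewrite <- HKg; simpl; split.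
  - intros H X; apply NNPP; intros HX; apply H; eauto.
  - intros H [X HX]; auto.
Qed.

End Main.

Unset Implicit Arguments.

Theorem corollary12p10 (M : L2structure) (HM : RCA0 M) :
  (Pi11_comprehension M <-> scattered_index_set_exists M) /\
  (Pi11_comprehension M <-> complete_index_set_exists M).
Proof.
  destruct (finite_set_coding (M := M)) as [B HB].
  split; split.
  - apply Pi11_scattered.
  - intros H; pose proof (scattered_Sigma01_comprehension H) as HJ.
    apply Pi11_comprehension_of_solutions; auto; intros K.
    exact (scattered_no_solution HJ HB K H).
  - apply Pi11_complete.
  - intros H; pose proof (complete_Sigma01_comprehension H) as HJ.
    apply Pi11_comprehension_of_solutions; auto; intros K.
    exact (complete_no_solution HJ HB K H).
Qed.
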